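(* Let $k\geq 1$. There exist matrices $A\in\mathbb{R}^{d\times d}$ such that for any $t$ with $1\leq t\leq o(\log d)$, for a random Cauchy matrix $S\in\mathbb{R}^{t\times d}$ whose entries are sampled i.i.d. from the Cauchy distribution $C(0,\gamma)$, where $\gamma$ is an arbitrary real number, with probability $0.99$ we have $$\min_{U\in\mathbb{R}^{d\times t}}\|USA-A\|_1\geq \Omega\!\left(\frac{\log d}{t\log t}\right)\min_{\mathrm{rank}\text{-}k\ A'}\|A'-A\|_1.$$
   Context: $\|M\|_1=\sum_{i,j}|M_{i,j}|$ is the entrywise $\ell_1$ norm; $C(0,\gamma)$ denotes the Cauchy distribution with location $0$ and scale $\gamma$. The minimum on the right is over all $d\times d$ matrices of rank at most $k$.
   Formalization: At t = 1, where log t = 0 makes log d/(t log t) undefined, log t is read as log 2; the scale γ is taken to be an arbitrary positive real, since C(0,γ) is a distribution only for γ > 0. *)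

(* Defs.v *)
From HB Require Import structures.
From mathcomp Require Export all_boot all_order all_algebra.
From mathcomp Require Export all_classical all_reals all_analysis.
Export Order.TTheory GRing.Theory Num.Theory.
Export numFieldNormedType.Exports.

Set Implicit Arguments.
Unset Strict Implicit.
Unset Printing Implicit Defensive.

Local Open Scope classical_set_scope.
Local Open Scope ring_scope.

Definition l1norm (R : realType) (m n : nat) (M : 'M[R]_(m, n)) : R :=
  \sum_(i < m) \sum_(j < n) `|M i j|.

(* The sets below are nonempty and bounded below by 0, so [inf] is the genuine
   greatest lower bound; in both cases the infimum is attained. *)

Definition min_rank_err (R : realType) (d k : nat) (A : 'M[R]_d) : R :=
  inf [set l1norm (A' - A) | A' in [set A' : 'M[R]_d | (\rank A' <= k)%N]].

Definition min_sketch_err (R : realType) (t d : nat) (S : 'M[R]_(t, d))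
    (A : 'M[R]_d) : R :=
  inf [set l1norm (U *m S *m A - A) | U in [set: 'M[R]_(d, t)]].

Definition cauchy_pdf (R : realType) (gamma x : R) : R :=
  (pi * gamma * (1 + (x / gamma) ^+ 2))^-1.

(* The law C(0, gamma), for gamma > 0. *)
Definition cauchy_law (R : realType) (gamma : R) (B : set R) : \bar R :=
  (\int[lebesgue_measure]_(x in B) (cauchy_pdf gamma x)%:E)%E.

Definition mutually_independent (R : realType) (disp : measure_display)
    (T : measurableType disp) (P : probability T R) (I : finType)
    (X : I -> {RV P >-> R}) : Prop :=
  forall (J : {set I}) (B : I -> set R), (forall i, measurable (B i)) ->
    P (\bigcap_(i in [set` J]) (X i @^-1` B i)) =
    (\prod_(i in J) P (X i @^-1` B i))%E.

Definition iid_cauchy (R : realType) (disp : measure_display)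
    (T : measurableType disp) (P : probability T R) (t d : nat) (gamma : R)
    (S : 'I_t -> 'I_d -> {RV P >-> R}) : Prop :=
  mutually_independent (fun ij : 'I_t * 'I_d => S ij.1 ij.2) /\
  forall i j (B : set R), measurable B ->
    distribution P (S i j) B = cauchy_law gamma B.

Definition sample_matrix (R : realType) (disp : measure_display)
    (T : measurableType disp) (P : probability T R) (t d : nat)
    (S : 'I_t -> 'I_d -> {RV P >-> R}) (w : T) : 'M[R]_(t, d) :=
  \matrix_(i < t, j < d) S i j w.

(* The rate log d / (t log t). At t = 1, where log t vanishes, log t is read as
   log 2; for t >= 2 the formula is literal. *)
Definition rate (R : realType) (d t : nat) : R :=
  ln (d%:R : R) / (t%:R * ln ((maxn 2 t)%:R : R)).

(* Main.v *)
(* The hard instance is A = diag(N, ..., N, 1, ..., 1) with k entries N = 2 d^2.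
   Keeping the k large entries shows that its rank-k error is at most d - k.  If
   t < k, then U S A has rank less than k and misses some large entry, an error
   of at least N.  If k <= t, let u be row k - 1 of U and x = u S: that row of
   U S A - A has l1 norm N |x_(k-1) - 1| + sum_(j >= k) |x_j| at least, so only
   u with |x_(k-1)| >= 1/2 matter, and it suffices that with high probability
   every u satisfies sum_(j >= k) |u . s_j| >= delta |u . s_(k-1)|, where s_j are
   the columns of S and delta is of order (d - k) log d / (t log t).

   Let |u|_oo = 1 and gamma = 1.  Heavy tails give |u . s_(k-1)| <= sum_i |S_i| =
   O(t log t) for the single column k - 1.  For a fixed u, take a coordinate with
   |u_i| = 1: whatever the rest of the sum u . s_j is, its i-th term exceeds x with
   the sign of the rest with probability at least c / x, hence
   P(|u . s_j| >= x) >= c / x; an exponential moment of the truncation at 2^L,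
   4^L ~ d, shows that sum_(j >= k) |u . s_j| is at least c (d - k) log d except with probability exp(- c L 2^L).  This beats the size
   exp(O(t log d)) of a net of the cube, since t = o(log d).

   All probabilities are computed in a finite product space: S / gamma is rounded
   to integers clamped to [-d^3, d^3], which costs at most t per column. *)
Require Import Defs.
From mathcomp Require Import measurable_realfun ring lra zify.

Set Implicit Arguments.
Unset Strict Implicit.
Unset Printing Implicit Defensive.

Local Open Scope classical_set_scope.
Local Open Scope ring_scope.

(** * Linear algebra of the hard instance *)

Lemma card_ord_ge (d k : nat) : #|[pred j : 'I_d | (k <= j)%N]| = (d - k)%N.
Proof.
rewrite -sum1_card big_mkcond /=.
have [kd|dk] := leqP k d; last first.
  rewrite big1 => [|i _]; first by lia.
  by rewrite inE; case: ifP => // ki; have := ltn_ord i; lia.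
rewrite (eq_bigr (fun i : 'I_d => if (k <= i)%N then 1%N else 0%N))
    => [|i _]; last first.
  by rewrite inE.
rewrite -(big_mkord xpredT (fun i => if (k <= i)%N then 1%N else 0%N)).
rewrite (big_cat_nat _ (n := k))//= big_nat_cond big1 ?add0n; last first.
  by move=> i; case: ifP => //; lia.
rewrite big_nat_cond (eq_bigr (fun=> 1%N)) -?big_nat_cond.
  by rewrite sum_nat_const_nat muln1.
by move=> i; case: ifP => //; lia.
Qed.

Lemma l1norm_ge0 (R : realType) m n (M : 'M[R]_(m, n)) : 0 <= l1norm M.
Proof. by apply: sumr_ge0 => i _; apply: sumr_ge0. Qed.

Lemma l1norm_row_le (R : realType) m n (M : 'M[R]_(m, n)) i :
  \sum_j `|M i j| <= l1norm M.
Proof.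
by rewrite /l1norm (bigD1 i)//= lerDl; do 2 apply: sumr_ge0 => ? _.
Qed.

Lemma l1normD (R : realType) m n (M N : 'M[R]_(m, n)) :
  l1norm (M + N) <= l1norm M + l1norm N.
Proof.
rewrite /l1norm -big_split; apply: ler_sum => i _ /=.
rewrite -big_split; apply: ler_sum => j _ /=.
by rewrite mxE ler_normD.
Qed.

Lemma l1normM (R : realType) m n p (M : 'M[R]_(m, n)) (N : 'M[R]_(n, p)) :
  l1norm (M *m N) <= l1norm M * l1norm N.
Proof.
rewrite {1 2}/l1norm mulr_suml; apply: ler_sum => i _.
apply: (@le_trans _ _ (\sum_(j < p) \sum_(l < n) `|M i l| * `|N l j|)).
  apply: ler_sum => j _; rewrite mxE; apply: (le_trans (ler_norm_sum _ _ _)).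
  by apply: ler_sum => l _; rewrite normrM.
rewrite exchange_big /= mulr_suml; apply: ler_sum => l _.
rewrite -mulr_sumr; apply: ler_wpM2l => //; exact: l1norm_row_le.
Qed.

(* A left null vector [v] of the rows [f] of [M] satisfies
   [v_j a_j = - sum_i v_i (M - A)_(f i, f j)]; take l1 norms. *)
Lemma diag_rank_gap (R : realType) (d m : nat) (A M : 'M[R]_d) (f : 'I_m -> 'I_d)
    (N : R) : injective f ->
  (forall i j, i != j -> A (f i) (f j) = 0) -> (forall i, N <= A (f i) (f i)) ->
  (\rank M < m)%N -> N <= l1norm (M - A).
Proof.
move=> fI A0 AN rM.
have : ~~ row_free (rowsub f M).
  rewrite /row_free rowsubE; apply/eqP => e.
  by have := mxrankM_maxr (rowsub f 1%:M) M; rewrite e; lia.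
apply: contraR; rewrite -ltNge => FN; apply: inj_row_free => v vM.
apply/eqP; apply: contraTT isT => v0.
pose s := \sum_i `|v 0 i|.
have s0 : 0 < s.
  rewrite lt_def sumr_ge0// andbT; apply: contra v0 => /eqP s0.
  apply/eqP/rowP => i; rewrite mxE.
  have := @psumr_eq0P _ _ _ _ (fun i _ => normr_ge0 (v 0 i)) s0 i isT.
  by move/eqP; rewrite normr_eq0 => /eqP.
suff : N * s <= l1norm (M - A) * s by rewrite ler_pM2r// leNgt FN.
rewrite mulr_sumr.
apply: (@le_trans _ _ (\sum_j \sum_i `|v 0 i| * `|(M - A) (f i) (f j)|)).
  apply: ler_sum => j _.
  have := congr1 (fun w : 'rV[R]_d => w 0 (f j)) vM; rewrite !mxE => vMj.
  have e : v 0 j * A (f j) (f j) = - \sum_i v 0 i * (M - A) (f i) (f j).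
    have -> : \sum_i v 0 i * (M - A) (f i) (f j) =
        \sum_i v 0 i * rowsub f M i (f j) - \sum_i v 0 i * A (f i) (f j).
      rewrite -sumrB; apply: eq_bigr => i _.
      by rewrite mxE [in RHS]mxE [X in _ + X]mxE mulrBr.
    rewrite vMj sub0r opprK (bigD1 j)//= big1 ?addr0// => i ij.
    by rewrite A0// mulr0.
  apply: (@le_trans _ _ `|v 0 j * A (f j) (f j)|).
    rewrite normrM mulrC; apply: ler_wpM2l => //.
    by apply: (le_trans (AN j)); rewrite ler_norm.
  rewrite e normrN; apply: (le_trans (ler_norm_sum _ _ _)).
  by apply: ler_sum => i _; rewrite normrM.
rewrite exchange_big /= /s mulr_sumr; apply: ler_sum => i _.
rewrite -mulr_sumr mulrC; apply: ler_wpM2r => //.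
apply: le_trans (l1norm_row_le (M - A) (f i)).
rewrite -(big_imset (fun j => `|(M - A) (f i) j|) (A := predT))/=; last first.
  by move=> x y _ _; exact: fI.
rewrite big_mkcond /=; apply: ler_sum => j _.
by case: ifP.
Qed.

Lemma le_min_rank_err (R : realType) (d k : nat) (A : 'M[R]_d) (C : R) :
  (forall M : 'M[R]_d, (\rank M <= k)%N -> C <= l1norm (M - A)) ->
  C <= min_rank_err k A.
Proof.
move=> h; apply: lb_le_inf; last by move=> _ [M rM <-]; exact: h.
by exists (l1norm (0 - A)), 0; rewrite //= mxrank0.
Qed.

Lemma min_rank_err_le (R : realType) (d k : nat) (A M : 'M[R]_d) :
  (\rank M <= k)%N -> min_rank_err k A <= l1norm (M - A).
Proof.
move=> rM; apply: ge_inf; last by exists M.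
by exists 0 => _ [M' _ <-]; exact: l1norm_ge0.
Qed.

Lemma le_min_sketch_err (R : realType) (t d : nat) (S : 'M[R]_(t, d))
    (A : 'M[R]_d) (C : R) :
  (C <= min_sketch_err S A) <-> (forall U, C <= l1norm (U *m S *m A - A)).
Proof.
split=> [h U|h].
  apply: (le_trans h); apply: ge_inf; last by exists U.
  by exists 0 => _ [M' _ <-]; exact: l1norm_ge0.
apply: lb_le_inf; last by move=> _ [U _ <-]; exact: h.
by exists (l1norm (0 *m S *m A - A)), 0.
Qed.

Definition hard_matrix (R : realType) (d k : nat) : 'M[R]_d :=
  diag_mx (\row_(j < d) if (j < k)%N then 2 * d%:R ^+ 2 else 1).

Lemma hard_matrixE (R : realType) (d k : nat) (i j : 'I_d) :
  hard_matrix R d k i j =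
  (if (j < k)%N then 2 * d%:R ^+ 2 else 1) * (i == j)%:R.
Proof.
rewrite !mxE; case: eqVneq => [->|_]; by rewrite ?mulr1n ?mulr0n ?mulr1 ?mulr0.
Qed.

(** All diagonal entries are at least 1, so [diag_rank_gap] applied to the whole index set gives
    error at least 1. The final inequality is thus not a comparison with zero. *)
Lemma hard_matrix_rank_err_gt0 (R : realType) (d k : nat) : (k < d)%N ->
  0 < min_rank_err k (hard_matrix R d k).
Proof.
move=> kd; apply: (@lt_le_trans _ _ 1) => //.
apply: le_min_rank_err => M rM.
apply: (@diag_rank_gap _ _ _ _ _ (@id 'I_d)) => //.
- by move=> i j /negPf ij; rewrite hard_matrixE ij mulr0.
- move=> i; rewrite hard_matrixE eqxx mulr1; case: ifP => // _.
  have : 1 <= d%:R :> R by rewrite ler1n; case: (d) kd.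
  by move=> d1; nra.
- exact: leq_ltn_trans kd.
Qed.

Lemma hard_matrix_rank_err_le (R : realType) (d k : nat) : (k <= d)%N ->
  min_rank_err k (hard_matrix R d k) <= (d - k)%:R.
Proof.
move=> kd; set A := hard_matrix R d k.
apply: (@le_trans _ _ (l1norm (A *m pid_mx k - A))).
  apply: min_rank_err_le; rewrite -[leqRHS](@rank_pid_mx R d d k)//.
  exact: mxrankM_maxr.
have e i j : (A *m pid_mx k - A) i j = (k <= i)%N%:R * - (i == j)%:R.
  rewrite mxE /A /hard_matrix mul_diag_mx !mxE.
  case: (eqVneq i j) => [->|ij] /=; last first.
    have -> : (i == j :> nat) = false by exact: negbTE.
    by rewrite ?andbF ?mulr0 ?mulr0n ?subrr ?oppr0 ?mulr0.
  rewrite eqxx /= mulr1n; case: ltnP => kj /=; ring.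
rewrite /l1norm (eq_bigr (fun i : 'I_d => (k <= i)%N%:R)).
  rewrite -natr_sum -card_ord_ge -sum1_card [in leRHS]big_mkcond ler_nat.
  by apply: leq_sum => i _; rewrite inE; case: (k <= i)%N.
move=> i _; rewrite (bigD1 i)//= e eqxx big1 ?addr0.
  by rewrite normrM normrN !normr1 mulr1 normr_nat.
by move=> j /negPf ji; rewrite e eq_sym ji oppr0 mulr0 normr0.
Qed.

Lemma hard_matrix_low_rank (R : realType) (t d k : nat) (S : 'M[R]_(t, d))
    (U : 'M[R]_(d, t)) : (t < k <= d)%N ->
  2 * d%:R ^+ 2 <= l1norm (U *m S *m hard_matrix R d k - hard_matrix R d k).
Proof.
move=> /andP[tk kd].
apply: (@diag_rank_gap _ _ _ _ _ (widen_ord kd)).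
- by move=> i j /(congr1 val) /= /val_inj.
- by move=> i j /negPf ij; rewrite hard_matrixE -val_eqE /= val_eqE ij mulr0.
- by move=> i; rewrite hard_matrixE eqxx mulr1 /= ltn_ord.
- apply: leq_ltn_trans tk; rewrite -mulmxA.
  by apply: (leq_trans (mxrankM_maxl _ _)); exact: rank_leq_col.
Qed.

Lemma hard_matrix_sketch (R : realType) (t d k : nat) (S : 'M[R]_(t, d))
    (U : 'M[R]_(d, t)) (r : 'I_d) (delta : R) : r.+1 = k ->
  (forall u : 'rV[R]_t,
     delta * `|(u *m S) 0 r| <= \sum_(j < d | (k <= j)%N) `|(u *m S) 0 j|) ->
  0 <= delta <= 2 * d%:R ^+ 2 ->
  delta / 2 <= l1norm (U *m S *m hard_matrix R d k - hard_matrix R d k).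
Proof.
move=> rk h /andP[d0 dN]; set A := hard_matrix R d k.
apply: le_trans (l1norm_row_le _ r).
pose x := row r U *m S.
have xE j : (U *m S *m A - A) r j =
    (x 0 j - (r == j)%:R) * if (j < k)%N then 2 * d%:R ^+ 2 else 1.
  rewrite mxE [X in _ + X]mxE hard_matrixE /A /hard_matrix mul_mx_diag !mxE.
  rewrite mulrBl [X in _ - X]mulrC; congr (_ * _ - _).
  by apply: eq_bigr => i _; rewrite mxE.
have [x1|x1] := leP (2^-1) `|x 0 r|.
  apply: (@le_trans _ _ (delta * `|x 0 r|) _).
    exact: ler_wpM2l.
  apply: (le_trans (h (row r U))); rewrite [leLHS]big_mkcond /=.
  apply: ler_sum => j _; case: leqP => // kj.
  rewrite xE ltnNge kj /= mulr1 (_ : r == j = false) ?subr0//.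
  by apply/eqP => rj; move: kj; rewrite -rk rj ltnn.
(* Now |x_r| < 1/2, so the entry at [r] alone costs at least half of 2 d^2, and [delta] is at most 2
   d^2. *)
rewrite (bigD1 r)//= xE eqxx -rk ltnSn.
apply: (@le_trans _ _ ((1 - `|x 0 r|) * (2 * d%:R ^+ 2))).
  have : 0 <= d%:R ^+ 2 :> R by rewrite exprn_ge0.
  by move=> d2; nra.
rewrite ler_wpDr ?sumr_ge0// normrM [X in _ <= _ * X]ger0_norm ?mulr_ge0//.
apply: ler_wpM2r; first by rewrite mulr_ge0.
by rewrite distrC -[X in X - _ <= _]normr1; exact: lerB_dist.
Qed.

(** * Reduction to rational sketch coefficients and measurability of the event *)

Lemma rat_matrix_dense (R : realType) m n (U : 'M[R]_(m, n)) (e : R) : 0 < e ->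
  exists V : 'M[rat]_(m, n), l1norm (map_mx ratr V - U) <= (m * n)%:R * e.
Proof.
move=> e0.
have h i j : exists q : rat, ratr q \in `]U i j, (U i j + e)[.
  by apply: rat_in_itvoo; rewrite ltrDl.
exists (\matrix_(i, j) sval (cid (h i j))).
rewrite natrM -mulrA.
have -> : m%:R * (n%:R * e) = \sum_(i < m) \sum_(j < n) e.
  by rewrite !sumr_const !card_ord !mulr_natl.
apply: ler_sum => i _; apply: ler_sum => j _; rewrite !mxE.
case: cid => q /=; rewrite in_itv /= => /andP[q1 q2].
by rewrite ger0_norm; lra.
Qed.

(** The error is continuous in [U], so rational matrices already detect a violation of the bound.
    This turns an uncountable family of conditions into a countable one. *)
Lemma le_min_sketch_err_rat (R : realType) (t d : nat) (S : 'M[R]_(t, d))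
    (A : 'M[R]_d) (C : R) :
  (C <= min_sketch_err S A) <->
  (forall V : 'M[rat]_(d, t), C <= l1norm (map_mx ratr V *m S *m A - A)).
Proof.
rewrite le_min_sketch_err; split=> [h V|h U]; first exact: h.
rewrite leNgt; apply/negP => UC.
set a := l1norm _ in UC; set n : R := (d * t)%:R; set b := l1norm (S *m A).
have b0 : 0 <= b by exact: l1norm_ge0.
have n0 : 0 <= n by [].
have nb0 : 0 < n * b + 1 by rewrite ltr_wpDl// mulr_ge0.
(* The excess [C - a] is shared out so that the perturbation, amplified by [b], stays strictly below
   it; the added 1 also covers [b = 0]. *)
have [V VU] := @rat_matrix_dense _ _ _ U ((C - a) / (n * b + 1))
  ltac:(by rewrite divr_gt0// subr_gt0).
have := h V; apply/negP; rewrite -ltNge.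
have -> : map_mx ratr V *m S *m A - A =
    (map_mx ratr V - U) *m (S *m A) + (U *m S *m A - A).
  by rewrite mulmxBl !mulmxA addrA subrK.
apply: (le_lt_trans (l1normD _ _)); rewrite -/a -ltrBrDr.
apply: (le_lt_trans (l1normM _ _)); rewrite -/b.
apply: (@le_lt_trans _ _ (n * ((C - a) / (n * b + 1)) * b)).
  exact: ler_wpM2r.
rewrite mulrAC mulrA ltr_pdivrMr// mulrC ltr_pM2l ?subr_gt0//.
by rewrite ltrDl.
Qed.

Lemma measurable_sketch_event (R : realType) (disp : measure_display)
    (T : measurableType disp) (P : probability T R) (t d : nat)
    (S : 'I_t -> 'I_d -> {RV P >-> R}) (A : 'M[R]_d) (C : R) :
  measurable [set w | C <= min_sketch_err (sample_matrix S w) A].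
Proof.
pose F (V : 'M[rat]_(d, t)) : set T :=
  [set w | C <= l1norm (map_mx ratr V *m sample_matrix S w *m A - A)].
have mF V : measurable (F V).
  rewrite (_ : F V = (fun w => C <=
      \sum_(i < d) \sum_(j < d) `|(\sum_(l < d) (\sum_(m < t)
         ratr (V i m) * S m l w) * A l j) - A i j|) @^-1` [set true]).
    rewrite -[X in measurable X]setTI; apply: measurable_fun_ler => //.
    apply: measurable_sum => i; apply: measurable_sum => j.
    apply: measurableT_comp => //; apply: measurable_funB => //.
    apply: measurable_sum => l; apply: measurable_funM => //.
    by apply: measurable_sum => m; apply: measurable_funM.
  have e w : l1norm (map_mx ratr V *m sample_matrix S w *m A - A) =
     \sum_(i < d) \sum_(j < d) `|(\sum_(l < d) (\sum_(m < t)
         ratr (V i m) * S m l w) * A l j) - A i j|.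
    apply: eq_bigr => i _; apply: eq_bigr => j _.
    rewrite !mxE; congr `|_ - _|; apply: eq_bigr => l _.
    by rewrite !mxE; congr (_ * _); apply: eq_bigr => m _; rewrite !mxE.
  by apply/seteqP; split => w; rewrite /F /= e.
(* Rational matrices are enumerated by [unpickle]; an index that codes no matrix contributes the
   full set. *)
rewrite (_ : [set _ | _] =
    \bigcap_n (if unpickle n is Some V then F V else setT)); last first.
  apply/seteqP; split => w /=.
    by move=> /le_min_sketch_err_rat h n _; case: unpickle => // V; exact: h.
  move=> h; apply/le_min_sketch_err_rat => V.
  by have := h (pickle V) I; rewrite pickleK.
by apply: bigcapT_measurable => n; case: unpickle.
Qed.

(** * Finite product distributions *)

Section FiniteProduct.
Implicit Type R : realType.

Definition ffun_upd (I T : finType) (f : {ffun I -> T}) i0 x : {ffun I -> T} :=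
  [ffun i => if i == i0 then x else f i].

Lemma sum_pred_natr (R : realType) (T : finType) (w : T -> R) (Q : pred T) :
  \sum_(x | Q x) w x = \sum_x w x * (Q x)%:R.
Proof.
rewrite big_mkcond /=; apply: eq_bigr => x _.
by case: (Q x); rewrite ?mulr1 ?mulr0.
Qed.

Lemma sum_ffun_prod (R : realType) (I T : finType) (w : I -> T -> R) :
  \sum_(f : {ffun I -> T}) \prod_i w i (f i) = \prod_i \sum_x w i x.
Proof. by rewrite bigA_distr_bigA. Qed.

Lemma sum_ffun_prod1 (R : realType) (I T : finType) (w : T -> R) :
  \sum_x w x = 1 -> \sum_(f : {ffun I -> T}) \prod_i w (f i) = 1.
Proof. by move=> w1; rewrite (sum_ffun_prod (fun=> w)) big1. Qed.

Lemma sum_marginal (R : realType) (I T : finType) (w F : T -> R) (i0 : I) :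
  \sum_x w x = 1 ->
  \sum_(f : {ffun I -> T}) (\prod_i w (f i)) * F (f i0) = \sum_x w x * F x.
Proof.
move=> w1.
pose w' i x := if i == i0 then w x * F x else w x.
transitivity (\sum_(f : {ffun I -> T}) \prod_i w' i (f i)).
  apply: eq_bigr => f _.
  rewrite (bigD1 i0)//= [RHS](bigD1 i0)//= /w' eqxx mulrAC; congr (_ * _).
  by apply: eq_bigr => i /negPf ii0; rewrite ii0.
rewrite sum_ffun_prod (bigD1 i0)//= [X in _ * X]big1 ?mulr1.
  by apply: eq_bigr => x _; rewrite /w' eqxx.
by move=> i /negPf ii0; rewrite -[RHS]w1; apply: eq_bigr => x _; rewrite /w' ii0.
Qed.

(** Adjoin an independent copy [x] and swap it with coordinate [i0]: the product weight is invariant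
    under this involution. The inner sum is then the conditional expectation given the other
    coordinates. *)
Lemma sum_resample (R : realType) (I T : finType) (w : T -> R) (i0 : I)
    (F : {ffun I -> T} -> R) : \sum_x w x = 1 ->
  \sum_(f : {ffun I -> T}) (\prod_i w (f i)) * F f =
  \sum_(f : {ffun I -> T}) (\prod_i w (f i)) * \sum_x w x * F (ffun_upd f i0 x).
Proof.
move=> w1.
pose sw (q : {ffun I -> T} * T) := (ffun_upd q.1 i0 q.2, q.1 i0).
have swK : involutive sw.
  move=> [f x]; rewrite /sw /=; congr (_, _); last by rewrite ffunE eqxx.
  by apply/ffunP => i; rewrite !ffunE; case: eqP => [->|].
have -> : \sum_(f : {ffun I -> T}) (\prod_i w (f i)) * F f =
    \sum_(q : {ffun I -> T} * T) (\prod_i w (q.1 i)) * w q.2 * F q.1.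
  transitivity (\sum_(f : {ffun I -> T}) \sum_x (\prod_i w (f i)) * w x * F f).
    by apply: eq_bigr => f _; rewrite -mulr_suml -mulr_sumr w1 mulr1.
  by rewrite pair_big.
rewrite (reindex_inj (inv_inj swK)) /=.
transitivity (\sum_(f : {ffun I -> T}) \sum_x
    (\prod_i w (f i)) * (w x * F (ffun_upd f i0 x))); last first.
  by apply: eq_bigr => f _; rewrite mulr_sumr.
rewrite pair_big /=; apply: eq_bigr => -[f x] _ /=.
rewrite mulrA; congr (_ * _).
rewrite (bigD1 i0)//= [in RHS](bigD1 i0)//= ffunE eqxx.
rewrite (eq_bigr (fun i => w (f i))); last first.
  by move=> i /negPf ii0; rewrite ffunE ii0.
ring.
Qed.

(* Conditionally on the other coordinates, summing to [Z], a large [v] of the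
   same sign as [Z] makes the total large, whatever [Z] is. *)
Lemma anticoncentration (R : realType) (I K : finType) (p v : K -> R)
    (u : I -> R) (i0 : I) (lam q : R) :
  (forall k, 0 <= p k) -> \sum_k p k = 1 ->
  q <= \sum_(k | lam <= v k) p k -> q <= \sum_(k | v k <= - lam) p k ->
  `|u i0| = 1 ->
  q <= \sum_(g : {ffun I -> K} | lam <= `|\sum_i u i * v (g i)|) \prod_i p (g i).
Proof.
move=> p0 p1 qp qn ui0.
rewrite sum_pred_natr (sum_resample i0)//.
rewrite -[leLHS]mul1r -[X in X * q](sum_ffun_prod1 I p1) mulr_suml.
apply: ler_sum => g _; apply: ler_wpM2l; first exact: prodr_ge0.
set Z := \sum_(i | i != i0) u i * v (g i).
have updE x : \sum_i u i * v (ffun_upd g i0 x i) = u i0 * v x + Z.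
  rewrite (bigD1 i0)//= ffunE eqxx; congr (_ + _).
  by apply: eq_bigr => i /negPf ii0; rewrite ffunE ii0.
under eq_bigr do rewrite updE.
rewrite -sum_pred_natr.
have aux (Q Q' : pred K) : (forall k, Q k -> Q' k) ->
    \sum_(k | Q k) p k <= \sum_(k | Q' k) p k.
  move=> QQ'; rewrite [leRHS]big_mkcond [leLHS]big_mkcond /=.
  apply: ler_sum => k _; case: ifP => Qk; first by rewrite QQ'.
  by case: ifP.
have [uE|uE] : u i0 = 1 \/ u i0 = -1.
  by move: ui0; case: ler0P => _ <-; rewrite ?opprK; [right|left].
- rewrite uE; have [Z0|Z0] := leP 0 Z.
    apply: (le_trans qp); apply: aux => k vk.
    by rewrite ler_normr mul1r; apply/orP; left; lra.
  apply: (le_trans qn); apply: aux => k vk.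
  by rewrite ler_normr mul1r; apply/orP; right; lra.
- rewrite uE; have [Z0|Z0] := leP 0 Z.
    apply: (le_trans qn); apply: aux => k vk.
    by rewrite ler_normr mulN1r; apply/orP; left; lra.
  apply: (le_trans qp); apply: aux => k vk.
  by rewrite ler_normr mulN1r; apply/orP; right; lra.
Qed.

(** * Dyadic truncation and tail bounds for independent sums *)

(** A stand-in for x truncated at 2^L, accurate up to constants. Its mean is a weighted sum of tail
    probabilities, so a tail of order 1/x contributes a constant at each of the L scales. *)
Definition dyadic (R : realType) (L : nat) (x : R) : R :=
  \sum_(l < L) 2 ^+ l * (2 ^+ l <= x)%R%:R.

Lemma dyadicS R L (x : R) :
  dyadic L.+1 x = dyadic L x + 2 ^+ L * (2 ^+ L <= x)%R%:R.
Proof. by rewrite /dyadic big_ord_recr. Qed.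

Lemma dyadic_ge0 R L (x : R) : 0 <= dyadic L x.
Proof. by apply: sumr_ge0 => l _; rewrite mulr_ge0// exprn_ge0. Qed.

Lemma dyadic_le_exp R L (x : R) : dyadic L x <= 2 ^+ L.
Proof.
elim: L => [|L IH]; first by rewrite /dyadic big_ord0 expr0.
rewrite dyadicS exprS; have : 0 <= (2:R) ^+ L by rewrite exprn_ge0.
by case: (_ <= x) => /=; rewrite ?mulr1 ?mulr0; lra.
Qed.

Lemma dyadic_le R L (x : R) : 0 <= x -> dyadic L x <= 2 * x.
Proof.
move=> x0; elim: L => [|L IH]; first by rewrite /dyadic big_ord0 mulr_ge0.
rewrite dyadicS; have := dyadic_le_exp L x.
by case: (boolP (_ <= x)) => /=; rewrite ?mulr1 ?mulr0; lra.
Qed.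

Lemma dyadic_full R L (x : R) : 2 ^+ L <= 2 * x -> dyadic L x = 2 ^+ L - 1.
Proof.
elim: L => [|L IH]; first by rewrite /dyadic big_ord0 subrr.
rewrite dyadicS exprS => Lx.
have p0 : 0 < (2:R) ^+ L by rewrite exprn_gt0.
have -> /= : 2 ^+ L <= x by lra.
by rewrite IH; lra.
Qed.

Lemma le_dyadic R L (x : R) : x < 2 ^+ L -> x <= 1 + dyadic L x.
Proof.
elim: L => [|L IH]; first by rewrite /dyadic big_ord0 expr0; lra.
have [xL _|Lx] := ltP x (2 ^+ L).
  apply: (le_trans (IH xL)); rewrite dyadicS.
  by rewrite addrA lerDl mulr_ge0// exprn_ge0.
have p0 : 0 < (2:R) ^+ L by rewrite exprn_gt0.
rewrite exprS dyadicS Lx dyadic_full /=; lra.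
Qed.

Lemma sum_dyadic R (T : finType) (w X : T -> R) L :
  \sum_x w x * dyadic L (X x) =
  \sum_(l < L) 2 ^+ l * \sum_(x | 2 ^+ l <= X x) w x.
Proof.
under eq_bigr do rewrite /dyadic mulr_sumr.
rewrite exchange_big /=; apply: eq_bigr => l _.
by rewrite [in RHS]sum_pred_natr mulr_sumr; apply: eq_bigr => x _; ring.
Qed.

(** Follows from exp(y) >= 1 + y; the linear bound reduces a Laplace transform to a mean. *)
Lemma expRN_le1 R (y : R) : 0 <= y <= 1 -> expR (- y) <= 1 - y / 2.
Proof.
move=> /andP[y0 y1]; rewrite expRN.
apply: (@le_trans _ _ (1 + y)^-1).
  by rewrite lef_pV2 ?posrE ?expR_gt0 ?expR_ge1Dx//; lra.
rewrite -[leLHS]mul1r ler_pdivrMr; last by lra.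
by nra.
Qed.

(** Division by 2^L puts the exponent in [0, 1], where [expRN_le1] applies. Scale [l] contributes
    2^l times c / 2^l to the mean of [dyadic], which is therefore at least c L. *)
Lemma dyadic_moment (R : realType) (T : finType) (w X : T -> R) (L : nat) (c : R) :
  (forall x, 0 <= w x) -> \sum_x w x = 1 ->
  (forall l, (l < L)%N -> c / 2 ^+ l <= \sum_(x | 2 ^+ l <= X x) w x) ->
  \sum_x w x * expR (- (dyadic L (X x) / 2 ^+ L)) <=
    expR (- (c * L%:R / 2 / 2 ^+ L)).
Proof.
move=> w0 w1 wX.
have p0 (n : nat) : 0 < (2:R) ^+ n by rewrite exprn_gt0.
apply: (@le_trans _ _ (\sum_x (w x - w x * dyadic L (X x) * (2 ^+ L)^-1 / 2))).
  apply: ler_sum => x _.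
  rewrite -[X in X - _]mulr1 -(mulrA (w x)) -(mulrA (w x)) -mulrBr.
  apply: ler_wpM2l => //; apply: expRN_le1.
  rewrite divr_ge0 ?dyadic_ge0 ?(ltW (p0 _))//=.
  by rewrite ler_pdivrMr// mul1r dyadic_le_exp.
rewrite sumrB w1 -!mulr_suml.
apply: le_trans (expR_ge1Dx _); rewrite lerD2l lerN2.
rewrite mulrAC ler_pM2r ?invr_gt0// ler_pM2r ?invr_gt0// sum_dyadic.
apply: (@le_trans _ _ (\sum_(l < L) c)).
  by rewrite sumr_const card_ord mulr_natr.
apply: ler_sum => l _; rewrite -ler_pdivrMl// mulrC.
exact: wX.
Qed.

(** Exponential Markov inequality. With [a] as in the proof, the event forces the truncated sum
    below [a], while independence and [dyadic_moment] give the Laplace transform exp(-2a / 2^L); the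
    factor exp(a / 2^L) leaves exp(-a / 2^L). *)
Lemma lower_tail (R : realType) (J T : finType) (w X : T -> R) (L : nat) (c : R)
    (D : pred J) :
  (forall x, 0 <= w x) -> (forall x, 0 <= X x) -> \sum_x w x = 1 ->
  (forall l, (l < L)%N -> c / 2 ^+ l <= \sum_(x | 2 ^+ l <= X x) w x) ->
  \sum_(f : {ffun J -> T} | \sum_(j | D j) X (f j) < #|D|%:R * c * L%:R / 8)
      \prod_j w (f j) <=
    expR (- (#|D|%:R * c * L%:R / 4 / 2 ^+ L)).
Proof.
move=> w0 X0 w1 wX.
have p0 (n : nat) : 0 < (2:R) ^+ n by rewrite exprn_gt0.
set a := #|D|%:R * c * L%:R / 4.
pose h j x := if D j then expR (- (dyadic L (X x) / 2 ^+ L)) else 1.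
apply: (@le_trans _ _ (\sum_(f : {ffun J -> T})
    expR (a / 2 ^+ L) * \prod_j (w (f j) * h j (f j)))).
  rewrite sum_pred_natr; apply: ler_sum => f _.
  rewrite big_split /= mulrCA; apply: ler_wpM2l; first exact: prodr_ge0.
  have -> : \prod_j h j (f j) =
      expR (- ((\sum_(j | D j) dyadic L (X (f j))) / 2 ^+ L)).
    rewrite mulr_suml -sumrN expR_sum [RHS]big_mkcond /=.
    by apply: eq_bigr.
  rewrite -expRD; case: (ltP (\sum_(j | D j) X (f j))) => /= fX; last first.
    exact: expR_ge0.
  rewrite -[leLHS]expR0 ler_expR -mulrBl divr_ge0 ?(ltW (p0 _))// subr_ge0.
  apply: (@le_trans _ _ (\sum_(j | D j) 2 * X (f j))).
    by apply: ler_sum => j _; exact: dyadic_le.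
  by rewrite -mulr_sumr /a; lra.
rewrite -mulr_sumr (sum_ffun_prod (fun j x => w x * h j x)).
apply: (@le_trans _ _ (expR (a / 2 ^+ L) *
    \prod_(j : J) if D j then expR (- (c * L%:R / 2 / 2 ^+ L)) else 1)).
  apply: ler_wpM2l; first exact: expR_ge0.
  apply: ler_prod => j _; rewrite /h; case: (D j).
    rewrite sumr_ge0/=; first exact: dyadic_moment.
    by move=> x _; rewrite mulr_ge0 ?expR_ge0.
  under eq_bigr do rewrite mulr1.
  by rewrite w1 ler01 lexx.
rewrite -big_mkcond prodr_const /= -expRM_natl -expRD ler_expR /a.
set A := (2 ^+ L)^-1; lra.
Qed.

(** The mean may be infinite, so truncate: the first term is a union bound for some value reaching
    2^M, the second is Markov's inequality for the remaining values, whose truncated mean is at most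
    1 + c M. *)
Lemma upper_tail (R : realType) (I K : finType) (p v : K -> R) (M : nat) (c a : R) :
  (forall k, 0 <= p k) -> (forall k, 0 <= v k) -> \sum_k p k = 1 -> 0 < a ->
  (forall l, (l <= M)%N -> \sum_(k | 2 ^+ l <= v k) p k <= c / 2 ^+ l) ->
  \sum_(g : {ffun I -> K} | a < \sum_i v (g i)) \prod_i p (g i) <=
    #|I|%:R * c / 2 ^+ M + #|I|%:R * (1 + c * M%:R) / a.
Proof.
move=> p0 v0 p1 a0 pv.
have q0 (n : nat) : 0 < (2:R) ^+ n by rewrite exprn_gt0.
have W0 (g : {ffun I -> K}) : 0 <= \prod_i p (g i) by exact: prodr_ge0.
(* Summed over coordinates, [F] dominates the indicator of the event: its first summand pays for one
   huge value, its second for the Markov bound. *)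
pose F k : R := (2 ^+ M <= v k)%R%:R + (1 + dyadic M (v k)) / a.
have F0 k : 0 <= F k.
  by rewrite addr_ge0// divr_ge0 ?(ltW a0)// addr_ge0// dyadic_ge0.
apply: (@le_trans _ _ (\sum_(g : {ffun I -> K}) \sum_i \prod_i p (g i) * F (g i))).
  rewrite sum_pred_natr; apply: ler_sum => g _.
  rewrite -mulr_sumr; apply: ler_wpM2l => //.
  case: ltP => /= ag; last exact: sumr_ge0.
  have [/existsP[i Mi]|/existsPn Mn] := boolP [exists i, 2 ^+ M <= v (g i)].
    rewrite (bigD1 i)//= -[leLHS]addr0 lerD ?sumr_ge0// /F Mi lerDl.
    by rewrite divr_ge0 ?(ltW a0)// addr_ge0// dyadic_ge0.
  apply: (@le_trans _ _ ((\sum_i v (g i)) / a)).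
    by rewrite ler_pdivlMr// mul1r ltW.
  rewrite mulr_suml; apply: ler_sum => i _; rewrite /F (negPf (Mn i)) add0r.
  rewrite ler_pM2r ?invr_gt0//; apply: le_dyadic.
  by rewrite ltNge.
rewrite exchange_big /=.
under eq_bigr do rewrite (sum_marginal F)//.
rewrite sumr_const -[X in X <= _]mulr_natl -!mulrA -mulrDr.
apply: ler_wpM2l => //.
rewrite /F; under eq_bigr do rewrite mulrDr.
rewrite big_split /= -sum_pred_natr lerD ?pv//.
under eq_bigr do rewrite mulrA mulrDr mulr1.
rewrite -mulr_suml ler_pM2r ?invr_gt0// big_split /= p1 lerD2l sum_dyadic.
apply: (@le_trans _ _ (\sum_(l < M) c)); last first.
  by rewrite sumr_const card_ord mulr_natr.
apply: ler_sum => l _; rewrite -ler_pdivlMl// mulrC.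
by apply: pv; exact: ltnW.
Qed.

Lemma union_bound (R : realType) (T N : finType) (W : T -> R) (Q : N -> pred T) :
  (forall x, 0 <= W x) ->
  \sum_(x | [exists n, Q n x]) W x <= \sum_n \sum_(x | Q n x) W x.
Proof.
move=> W0; under [leRHS]eq_bigr do rewrite sum_pred_natr.
rewrite exchange_big sum_pred_natr /=; apply: ler_sum => x _.
rewrite -mulr_sumr; apply: ler_wpM2l => //.
have [/existsP[n Qn]|_] /= := boolP [exists n, Q n x]; last exact: sumr_ge0.
by rewrite (bigD1 n)//= Qn lerDl sumr_ge0.
Qed.

End FiniteProduct.

(** * Tails of the Cauchy law *)

Lemma atan_le (R : realType) (y : R) : 0 < y -> atan y <= y.
Proof.
move=> y0.
have datan z : z \in `]0, y[ -> is_derive z 1 atan (1 + z ^+ 2)^-1.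
  by move=> _; exact: is_derive1_atan.
have catan : {within `[0, y], continuous (@atan R)}.
  by apply: continuous_subspaceT => z; exact: continuous_atan.
have [z _] := MVT y0 datan catan.
rewrite atan0 !subr0 => ->; rewrite -[leRHS]mul1r ler_pM2r//.
by rewrite invf_le1 ?lerDl ?sqr_ge0// ltr_wpDr// sqr_ge0.
Qed.

(** Complementary angles: atan y = pi / 2 - atan (1 / y), and [atan_le] bounds the last term. *)
Lemma atan_ge (R : realType) (y : R) : 0 < y -> pi / 2 - y^-1 <= atan y.
Proof.
move=> y0; set z := atan y^-1.
have z0 : 0 < z by rewrite /z -[ltLHS](@atan0 R) lt_atan// invr_gt0.
have zpi : z < pi / 2 by exact: atan_ltpi2.
have cz : cos z != 0.
  by rewrite gt_eqF// cos_gt0_pihalf// zpi andbT; lra.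
have -> : y = tan (pi / 2 - z).
  rewrite /tan -opprB sinN cosN sinBpihalf cosBpihalf opprK.
  by rewrite -[y]invrK -(atanK y^-1) -/z /tan invf_div.
rewrite tanK; last by rewrite in_itv /=; apply/andP; split; lra.
have -> : (tan (pi / 2 - z))^-1 = tan z.
  by rewrite /tan -opprB sinN cosN sinBpihalf cosBpihalf opprK invf_div.
by rewrite lerD2l lerN2 /z atanK atan_le// invr_gt0.
Qed.

Lemma cauchy_pdf_cont (R : realType) (gamma : R) :
  0 < gamma -> continuous (cauchy_pdf gamma).
Proof.
move=> g0 x; apply: cvgV.
  rewrite mulf_neq0//; first by rewrite mulf_neq0// gt_eqF// pi_gt0.
  by rewrite gt_eqF// ltr_wpDr// sqr_ge0.
apply: cvgM; first exact: cvg_cst.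
apply: cvgD; first exact: cvg_cst.
by apply: cvgM; (apply: cvgM; [exact: cvg_id|exact: cvg_cst]).
Qed.

Lemma cauchy_pdf_measurable (R : realType) (gamma : R) (D : set R) :
  0 < gamma -> measurable D -> measurable_fun D (fun x : R => (cauchy_pdf gamma x)%:E).
Proof.
move=> g0 mD; apply/measurable_EFinP.
apply: measurable_funTS; apply: continuous_measurable_fun.
exact: cauchy_pdf_cont.
Qed.

Lemma cauchy_law_center (R : realType) (gamma lam : R) : 0 < gamma -> 0 < lam ->
  cauchy_law gamma `[- (lam * gamma), lam * gamma]%classic =
  (2 * atan lam / pi)%:E.
Proof.
move=> g0 l0; have lg : 0 < lam * gamma by exact: mulr_gt0.
have gn : gamma != 0 by rewrite gt_eqF.
have dF (x : R) :
    is_derive x 1 (fun x : R => atan (x / gamma) / pi) (cauchy_pdf gamma x).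
  rewrite /cauchy_pdf.
  have pn : pi != 0 :> R by rewrite gt_eqF// pi_gt0.
  have dn : 1 + (x / gamma) ^+ 2 != 0 by rewrite gt_eqF// ltr_wpDr// sqr_ge0.
  have d1 : is_derive x 1 (fun x : R => x / gamma) gamma^-1.
    have := @is_deriveZ _ _ _ id gamma^-1 x 1 1 _.
    rewrite /GRing.scale /= mulr1 => h.
    rewrite (_ : (fun x => _) = gamma^-1 \*: id); last first.
      by apply/funext => z; rewrite /= mulrC.
    exact: h.
  have d2 := @is_derive1_comp R (@atan R) (fun x : R => x / gamma) x _ _
    (is_derive1_atan (x / gamma)) d1.
  have d3 := @is_deriveZ _ _ _ (atan \o (fun x : R => x / gamma)) pi^-1 x 1 _ d2.
  have eF : (fun x => atan (x / gamma) / pi) =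
     pi^-1 \*: (atan \o (fun x : R => x / gamma)).
    by apply/funext => z; rewrite /= mulrC.
  rewrite eF; apply: is_derive_eq d3 _.
  by rewrite /GRing.scale /= !invfM; ring.
have cF (x : R) : {for x, continuous (fun x : R => atan (x / gamma) / pi)}.
  by apply: differentiable_continuous; apply/derivable1_diffP; exact: ex_derive.
rewrite /cauchy_law (@continuous_FTC2 _ _ (fun x : R => atan (x / gamma) / pi)).
- rewrite -EFinB mulNr !mulfK// atanN; congr (_%:E); ring.
- by lra.
- by apply: continuous_subspaceT; exact: cauchy_pdf_cont.
- split.
  + by move=> x _; exact: ex_derive.
  + by apply: cvg_at_right_filter; exact: cF.
  + by apply: cvg_at_left_filter; exact: cF.
- by move=> x _; rewrite derive1E; exact: derive_val.
Qed.

(** Both intervals have length [lam * gamma] and lie in |x| <= 2 lam gamma, where pi < 4 and 1 + 4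
    lam^2 <= 5 lam^2 bound the density below by 1 / (20 lam^2 gamma). *)
Lemma cauchy_law_itv_ge (R : realType) (gamma lam a : R) : 0 < gamma -> 1 <= lam ->
  a = lam * gamma \/ a = - (2 * lam * gamma) ->
  ((20 * lam)^-1%:E <= cauchy_law gamma `[a, (a + lam * gamma)%R])%E.
Proof.
move=> g0 l1 aE; have lg : 0 < lam * gamma by rewrite mulr_gt0//; lra.
have pi4 : pi < 4 :> R by have := @pihalf_lt2 R; lra.
have pi0 : 0 < pi :> R by exact: pi_gt0.
have gn : gamma != 0 by rewrite gt_eqF.
pose q := (20 * lam * (lam * gamma))^-1.
have q0 : 0 <= q by rewrite invr_ge0 mulr_ge0 ?(ltW lg)//; lra.
apply: (@le_trans _ _ (\int[lebesgue_measure]_(x in `[a, (a + lam * gamma)%R])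
     cst q%:E x)%E).
  rewrite integral_cst//= lebesgue_measure_itv /= lte_fin ltrDl lg.
  rewrite -EFinB -EFinM lee_fin addrAC subrr add0r /q (invfM (20 * lam)).
  by rewrite mulfVK ?gt_eqF.
rewrite /cauchy_law; apply: ge0_le_integral => //.
- exact: cauchy_pdf_measurable.
move=> x /=; rewrite in_itv /= => /andP[ax xa]; rewrite lee_fin.
have x2 : (x / gamma) ^+ 2 <= 4 * lam ^+ 2.
  have xg : x = x / gamma * gamma by rewrite mulfVK.
  set y := x / gamma in xg *.
  have y1 : y <= 2 * lam.
    rewrite -(ler_pM2r g0) -xg; apply: (le_trans xa).
    by case: aE => ->; nra.
  have y2 : - (2 * lam) <= y.
    rewrite -(ler_pM2r g0) -xg; apply: le_trans ax.
    by case: aE => ->; nra.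
  by nra.
have X0 := sqr_ge0 (x / gamma).
have l2 : 1 <= lam ^+ 2 by nra.
rewrite /q /cauchy_pdf lef_pV2 ?posrE; last 2 first.
- by rewrite mulr_gt0//; lra.
- by rewrite !mulr_gt0//; lra.
set X := (x / gamma) ^+ 2 in x2 X0 *.
rewrite (_ : 20 * lam * (lam * gamma) = 4 * gamma * (5 * lam ^+ 2)); last by ring.
apply: ler_pM; [by rewrite mulr_ge0// ltW| by lra | | by lra].
by rewrite ler_pM2r// ltW.
Qed.

(** * Quantization *)

Local Notation column t B := {ffun 'I_t -> 'I_(B.*2).+1}.

(* [qval (quant B x)] is the integer part of [x] clamped to [-B, B]. *)
Definition quant (R : realType) (B : nat) (x : R) : 'I_(B.*2).+1 :=
  inord (minn B.*2 (Num.truncn (x + B%:R))).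

Definition qval (R : realType) (B : nat) (k : 'I_(B.*2).+1) : R :=
  k%:R - B%:R.

Lemma quant_gt (R : realType) B (x : R) n : (n < B.*2)%N ->
  (n < quant B x)%N = (n.+1%:R <= x + B%:R).
Proof.
move=> nB; rewrite inordK ?ltnS ?geq_minl// leq_min nB /=.
by rewrite truncn_gt_nat.
Qed.

Lemma qval_quant_ge (R : realType) B (x : R) n : (0 < n <= B)%N ->
  (n%:R <= qval R (quant B x)) = (n%:R <= x).
Proof.
move=> /andP[n0 nB]; rewrite /qval lerBrDr -natrD ler_nat.
have -> : (n + B <= quant B x)%N = ((n + B).-1 < quant B x)%N by lia.
rewrite quant_gt; last by lia.
by rewrite prednK ?addn_gt0 ?n0// natrD lerD2r.
Qed.

(** Rounding goes downwards, hence a shift by one that the upper threshold in [qval_quant_ge] does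
    not have. *)
Lemma qval_quant_le (R : realType) B (x : R) n : (0 < n <= B)%N ->
  (qval R (quant B x) <= - n%:R) = (x < 1 - n%:R).
Proof.
move=> /andP[n0 nB]; rewrite /qval lerBlDr addrC -natrB// ler_nat.
rewrite leqNgt quant_gt; last by lia.
by rewrite -ltNge -natr1 natrB//; apply/idP/idP; lra.
Qed.

Lemma qval_quant_itv (R : realType) B (x : R) : `|qval R (quant B x)| < B%:R ->
  qval R (quant B x) <= x < qval R (quant B x) + 1.
Proof.
rewrite /qval ltr_norml => /andP[k0 kB].
have {}k0 : (0 < quant B x)%N by rewrite -(@ltr_nat R); lra.
have {}kB : (quant B x < B.*2)%N.
  have BE : (B.*2)%:R = B%:R + B%:R :> R by rewrite -addnn natrD.
  by rewrite -(@ltr_nat R) BE; lra.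
have := quant_gt x (leq_ltn_trans (leq_pred _) kB).
rewrite prednK// leqnn => /esym xge.
have := quant_gt x kB.
rewrite ltnn -natr1 => /esym/negbT; rewrite -ltNge => xlt.
by apply/andP; split; lra.
Qed.

Lemma measurable_quant (R : realType) B (gamma : R) (k : 'I_(B.*2).+1) :
  measurable [set x : R | quant B (x / gamma) = k].
Proof.
have mg n : measurable [set x : R | (n < quant B (x / gamma))%N].
  have [nB|nB] := ltnP n B.*2; last first.
    rewrite (_ : [set _ | _] = set0)//; apply/seteqP; split => // x /=.
    by have := ltn_ord (quant B (x / gamma)); lia.
  rewrite (_ : [set _ | _] =
      (fun x : R => n.+1%:R <= x / gamma + B%:R) @^-1` [set true]); last first.
    by apply/seteqP; split => x /=; rewrite quant_gt.
  rewrite -[X in measurable X]setTI; apply: measurable_fun_ler => //.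
  apply: measurable_funD => //; exact: measurable_funM.
have [k0|k0] := posnP k.
  rewrite (_ : [set _ | _] = ~` [set x : R | (0 < quant B (x / gamma))%N]).
    exact: measurableC.
  apply/seteqP; split => x /=; first by move=> ->; rewrite k0.
  by move/negP; rewrite -leqNgt leqn0 => /eqP kx; apply/val_inj; rewrite /= kx k0.
rewrite (_ : [set _ | _] = [set x : R | (k.-1 < quant B (x / gamma))%N] `\`
    [set x : R | (k < quant B (x / gamma))%N]).
  exact: measurableD.
apply/seteqP; split => x /=.
  by move=> ->; rewrite ltnn prednK.
by case=> h1 /negP h2; apply/val_inj => /=; lia.
Qed.

Lemma measure_finpart (R : realType) (disp : measure_display)
    (T : measurableType disp) (mu : {measure set T -> \bar R}) (K : finType)
    (q : T -> K) (Q : pred K) :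
  (forall k, measurable [set x | q x = k]) ->
  measurable [set x | Q (q x)] /\
  mu [set x | Q (q x)] = (\sum_(k | Q k) mu [set x | q x = k])%E.
Proof.
move=> mq.
suff h (s : seq K) : uniq s -> measurable [set x | q x \in s] /\
    mu [set x | q x \in s] = (\sum_(k <- s) mu [set x | q x = k])%E.
  have [m1 m2] := h _ (enum_uniq Q).
  rewrite big_enum in m2.
  rewrite (_ : [set x | Q (q x)] = [set x | q x \in enum Q])//.
  by apply/seteqP; split => x /=; rewrite mem_enum.
elim: s => [|k s IH] /=.
  by rewrite (_ : [set _ | _] = set0) ?big_nil ?measure0//; apply/seteqP; split.
move=> /andP[ks us]; have [m1 m2] := IH us.
have -> : [set x | q x \in k :: s] = [set x | q x = k] `|` [set x | q x \in s].
  apply/seteqP; split => x /=; rewrite inE.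
    by case/predU1P; [left|right].
  by case=> [->|->]; rewrite ?eqxx ?orbT.
split; first exact: measurableU.
rewrite big_cons -m2; apply: measureU => //.
by apply/seteqP; split => // x /= [-> ]; rewrite (negPf ks).
Qed.

(** * Law of a quantized Cauchy variable *)

Definition cell_prob (R : realType) (B : nat) (gamma : R) (k : 'I_(B.*2).+1) : R :=
  fine (cauchy_law gamma [set x | quant B (x / gamma) = k]).

Section Cell.
Variables (R : realType) (disp : measure_display) (T : measurableType disp).
Variables (P : probability T R) (gamma : R) (X : {RV P >-> R}).
Hypothesis g0 : 0 < gamma.
Hypothesis hX : forall D : set R, measurable D ->
  distribution P X D = cauchy_law gamma D.
Variable B : nat.
Let p := @cell_prob R B gamma.

(** Finiteness is read off from [X], whose distribution is [cauchy_law]; total mass one and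
    monotonicity are inherited below in the same way. *)
Lemma cell_probE k : cauchy_law gamma [set x | quant B (x / gamma) = k] = (p k)%:E.
Proof.
have mk := measurable_quant gamma k.
by rewrite /p /cell_prob fineK// -hX// fin_num_measure.
Qed.

Lemma cell_prob_ge0 k : 0 <= p k.
Proof. by rewrite -lee_fin -cell_probE -hX//; exact: measurable_quant. Qed.

Lemma cell_prob_sum (Q : pred 'I_(B.*2).+1) :
  measurable [set x | Q (quant B (x / gamma))] /\
  cauchy_law gamma [set x | Q (quant B (x / gamma))] = (\sum_(k | Q k) p k)%:E.
Proof.
have [m1 m2] := measure_finpart (distribution P X) Q (@measurable_quant R B gamma).
split; first exact: m1.
rewrite -hX; last exact: m1.
rewrite m2 -sumEFin; apply: eq_bigr => k _.
by rewrite -cell_probE -hX//; exact: measurable_quant.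
Qed.

Lemma cell_prob_sum1 : \sum_k p k = 1.
Proof.
apply: EFin_inj; have [m1 <-] := cell_prob_sum predT.
rewrite -hX// (_ : [set x | _] = setT) ?probability_setT//.
by apply/seteqP; split.
Qed.

Lemma cauchy_law_le (D E : set R) : measurable D -> measurable E -> D `<=` E ->
  (cauchy_law gamma D <= cauchy_law gamma E)%E.
Proof. by move=> mD mE DE; rewrite -!hX//; apply: le_measure; rewrite ?inE. Qed.

Lemma cell_prob_upper n : (0 < n <= B)%N ->
  (20 * n%:R)^-1 <= \sum_(k | n%:R <= qval R k) p k.
Proof.
move=> nB; have n1 : 1 <= n%:R :> R by rewrite ler1n; case/andP: nB.
rewrite -lee_fin; have [m1 <-] := cell_prob_sum (fun k => n%:R <= qval R k).
apply: (le_trans (cauchy_law_itv_ge g0 n1 (or_introl erefl))).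
apply: cauchy_law_le => //.
move=> x /=; rewrite in_itv /= => /andP[x1 _].
by rewrite qval_quant_ge// ler_pdivlMr.
Qed.

Lemma cell_prob_lower n : (0 < n <= B)%N ->
  (20 * n%:R)^-1 <= \sum_(k | qval R k <= - n%:R) p k.
Proof.
move=> nB; have n1 : 1 <= n%:R :> R by rewrite ler1n; case/andP: nB.
rewrite -lee_fin; have [m1 <-] := cell_prob_sum (fun k => qval R k <= - n%:R).
apply: (le_trans (cauchy_law_itv_ge g0 n1 (or_intror erefl))).
apply: cauchy_law_le => //.
move=> x /=; rewrite in_itv /= => /andP[_ x1].
rewrite qval_quant_le// ltr_pdivrMr//.
have g1 : 0 < gamma := g0.
have h : - (2 * n%:R * gamma) + n%:R * gamma < (1 - n%:R) * gamma by lra.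
exact: le_lt_trans x1 h.
Qed.

(** After rounding down, |qval| >= n still forces |x| > (n - 1) gamma up to a null endpoint-free
    margin of one unit; by [atan_ge] the mass outside is at most 2 / (pi (n - 1)), and pi >= 2 with
    n <= 2 (n - 1) finishes. *)
Lemma cell_prob_tail n : (0 < n)%N ->
  \sum_(k | n%:R <= `|qval R k|) p k <= 2 / n%:R.
Proof.
(* At n = 1 the radius n - 1 vanishes, but the claimed bound 2 is trivial. *)
move=> n0; have [->|n1] := eqVneq n 1%N.
  rewrite divr1; apply: (@le_trans _ _ 1); last by lra.
  rewrite -cell_prob_sum1 big_mkcond /=; apply: ler_sum => k _.
  by case: ifP => // _; exact: cell_prob_ge0.
have {n0 n1} n2 : (2 <= n)%N by lia.
have nR : 2 <= n%:R :> R by rewrite ler_nat.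
pose lam : R := n%:R - 1.
have g1 : 0 < gamma := g0.
have l0 : 0 < lam by rewrite /lam; lra.
pose C := `[- (lam * gamma), lam * gamma]%classic : set R.
apply: (@le_trans _ _ (1 - 2 * atan lam / pi)).
  rewrite -lee_fin; have [m1 <-] := cell_prob_sum (fun k => n%:R <= `|qval R k|).
  rewrite EFinB -(cauchy_law_center g0 l0) -/C.
  have mC : measurable C by exact: measurable_itv.
  have <- : cauchy_law gamma (~` C) = (1 - cauchy_law gamma C)%E.
    rewrite -!hX//; last exact: measurableC.
    exact: probability_setC.
  apply: cauchy_law_le => //; first exact: measurableC.
  move=> x /= nx; rewrite /C /= in_itv /= => /andP[xl xr].
  have nB : (0 < n <= B)%N.
    rewrite (leq_trans _ n2)//= -(@ler_nat R); apply: (le_trans nx).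
    rewrite /qval ler_norml; have := ltn_ord (quant B (x / gamma)).
    have BE : (B.*2)%:R = B%:R + B%:R :> R by rewrite -addnn natrD.
    rewrite ltnS -(@ler_nat R) BE => h.
    by have := ler0n R (quant B (x / gamma)); move=> h'; apply/andP; split; lra.
  move: nx; rewrite ler_normr lerNr => /orP[|].
    rewrite qval_quant_ge// ler_pdivlMr//.
    by rewrite /lam in xr; nra.
  rewrite qval_quant_le// ltr_pdivrMr//.
  by rewrite /lam in xl; nra.
have pi2 := @pi_ge2 R.
have pi0 : 0 < pi :> R by lra.
rewrite -(ler_pM2r pi0) mulrBl mulfVK ?gt_eqF// mul1r.
have a1 := atan_ge l0.
have lV : lam^-1 <= 2 / n%:R.
  rewrite -[leLHS]mul1r ler_pdivrMr// mulrAC ler_pdivlMr; last by lra.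
  by rewrite /lam; lra.
have nV : 0 < 2 / n%:R :> R by rewrite divr_gt0//; lra.
by set Y := 2 / _ in lV nV *; nra.
Qed.

End Cell.

(** Passage from the probability space to finite sums: each fibre of the quantized matrix is an
    intersection of independent events, so its probability is a product of cell masses. *)
Lemma iid_quant_ge (R : realType) (disp : measure_display) (T : measurableType disp)
    (P : probability T R) (t d B : nat) (gamma : R)
    (S : 'I_t -> 'I_d -> {RV P >-> R}) (E : set T)
    (Q : pred {ffun 'I_d -> column t B}) :
  0 < gamma -> iid_cauchy gamma S -> measurable E ->
  (forall w, Q [ffun j => [ffun i => quant B (S i j w / gamma)]] -> E w) ->
  ((\sum_(f | Q f) \prod_j \prod_i cell_prob gamma (f j i))%:E <= P E)%E.
Proof.
move=> g0 [ind law] mE QE.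
pose q w := [ffun j => [ffun i => quant B (S i j w / gamma)]]
  : {ffun 'I_d -> column t B}.
have mD i j k : measurable (S i j @^-1` [set x | quant B (x / gamma) = k]).
  by rewrite -[X in measurable X]setTI; apply: measurable_funP => //;
     exact: measurable_quant.
have qE f : [set w | q w = f] = \bigcap_(ij in [set` [set: 'I_t * 'I_d]%SET])
    (S ij.1 ij.2 @^-1` [set x | quant B (x / gamma) = f ij.2 ij.1]).
  apply/seteqP; split => w /=.
    by move=> <- [i j] _ /=; rewrite !ffunE.
  move=> h; apply/ffunP => j; apply/ffunP => i; rewrite !ffunE.
  by apply: (h (i, j)); rewrite /= inE.
have mq f : measurable [set w | q w = f].
  by rewrite qE; apply: fin_bigcap_measurable => //.
have [m1 m2] := measure_finpart P Q mq.
apply: (@le_trans _ _ (P [set w | Q (q w)])); last first.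
  by apply: le_measure; rewrite ?inE.
rewrite m2 -sumEFin; apply: lee_sum => f _.
pose D (ij : 'I_t * 'I_d) : set R := [set x | quant B (x / gamma) = f ij.2 ij.1].
have := @ind [set: _]%SET D (fun ij => measurable_quant gamma _).
rewrite /= -qE => ->.
rewrite exchange_big /= pair_big /= -prodEFin.
rewrite [leRHS](eq_bigl xpredT); last by move=> ij; rewrite inE.
rewrite le_eqVlt; apply/orP; left; apply/eqP; apply: eq_bigr => -[i j] _ /=.
by rewrite -(cell_probE (law i j)) -(law i j) //; exact: measurable_quant.
Qed.

(** * The high-probability event *)

Lemma sum_orb_le (R : realType) (T : finType) (W : T -> R) (Q1 Q2 : pred T) :
  (forall x, 0 <= W x) ->
  \sum_(x | Q1 x || Q2 x) W x <= \sum_(x | Q1 x) W x + \sum_(x | Q2 x) W x.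
Proof.
move=> W0; rewrite [leLHS]big_mkcond [X in _ <= X + _]big_mkcond.
rewrite [X in _ <= _ + X]big_mkcond -big_split /=; apply: ler_sum => x _.
by have := W0 x; case: (Q1 x); case: (Q2 x) => /=; lra.
Qed.

Lemma sum_event_marginal (R : realType) (I T : finType) (w : T -> R) (i0 : I)
    (Q : pred T) : \sum_x w x = 1 ->
  \sum_(f : {ffun I -> T} | Q (f i0)) \prod_i w (f i) = \sum_(x | Q x) w x.
Proof.
move=> w1; rewrite [LHS]sum_pred_natr [RHS]sum_pred_natr.
exact: (sum_marginal (fun x => (Q x)%:R)).
Qed.

(** Strictness excludes both end values, where clamping may have occurred, as [qval_quant_itv]
    requires. *)
Definition in_range (R : realType) (t d B : nat)
    (f : {ffun 'I_d -> column t B}) :=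
  [forall q : 'I_d * 'I_t, `|qval R (f q.1 q.2)| < B%:R].

Definition small_column (R : realType) (t d B : nat) (r : 'I_d) (a : R)
    (f : {ffun 'I_d -> column t B}) :=
  \sum_i `|qval R (f r i)| <= a.

(* The grid points [qval (n i) / B] form a net of the cube [-1, 1]^t. *)
Definition large_net (R : realType) (t d B k : nat) (a : R)
    (f : {ffun 'I_d -> column t B}) :=
  [forall n : column t B,
    [exists i, `|qval R (n i) / B%:R| == 1] ==>
    (a <= \sum_(j < d | (k <= j)%N)
            `|\sum_i qval R (n i) / B%:R * qval R (f j i)|)].

Section Good.
Variables (R : realType) (t d B k : nat) (p : 'I_(B.*2).+1 -> R).
Hypothesis p_ge0 : forall x, 0 <= p x.
Hypothesis p_sum1 : \sum_x p x = 1.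

Let W (f : {ffun 'I_d -> column t B}) := \prod_j \prod_i p (f j i).

Let W_ge0 f : 0 <= W f.
Proof. by apply: prodr_ge0 => j _; exact: prodr_ge0. Qed.

Let w_sum1 : \sum_(g : column t B) \prod_i p (g i) = 1.
Proof. exact: sum_ffun_prod1. Qed.

Lemma out_of_range_le (c : R) :
  \sum_(x | B%:R <= `|qval R x|) p x <= c ->
  \sum_(f | ~~ in_range R f) W f <= (d * t)%:R * c.
Proof.
move=> h.
pose Q (q : 'I_d * 'I_t) (f : {ffun 'I_d -> column t B}) :=
  B%:R <= `|qval R (f q.1 q.2)|.
rewrite (eq_bigl (fun f => [exists q, Q q f])); last first.
  move=> f; rewrite /in_range negb_forall; apply: eq_existsb => q.
  by rewrite -leNgt.
apply: (le_trans (union_bound Q W_ge0)).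
have -> : (d * t)%:R * c = \sum_(q : 'I_d * 'I_t) c.
  by rewrite sumr_const card_prod !card_ord mulr_natl.
apply: ler_sum => -[j i] _; rewrite /Q /=.
rewrite (@sum_event_marginal _ _ _ (fun g : column t B => \prod_i p (g i)) j
  (fun g => B%:R <= `|qval R (g i)|))//.
by rewrite (@sum_event_marginal _ _ _ p i (fun x => B%:R <= `|qval R x|)).
Qed.

Lemma large_column_le (r : 'I_d) (M : nat) (c a : R) : 0 < a ->
  (forall l, (l <= M)%N -> \sum_(x | 2 ^+ l <= `|qval R x|) p x <= c / 2 ^+ l) ->
  \sum_(f | ~~ small_column r a f) W f <=
    t%:R * c / 2 ^+ M + t%:R * (1 + c * M%:R) / a.
Proof.
move=> a0 h.
rewrite (eq_bigl (fun f : {ffun 'I_d -> column t B} =>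
    a < \sum_i `|qval R (f r i)|)); last first.
  by move=> f; rewrite /small_column -ltNge.
rewrite (@sum_event_marginal _ _ _ (fun g : column t B => \prod_i p (g i)) r
  (fun g => a < \sum_i `|qval R (g i)|))//.
have := @upper_tail R 'I_t _ p (fun x => `|qval R x|) M c a p_ge0
  (fun x => normr_ge0 _) p_sum1 a0 h.
by rewrite card_ord.
Qed.

(** Union bound over at most (2B + 1)^t grid points. For each of them [anticoncentration] supplies
    the tail of a single column, and [lower_tail] combines the independent columns. *)
Lemma small_net_le (L : nat) (c : R) :
  (forall l, (l < L)%N -> c / 2 ^+ l <= \sum_(x | 2 ^+ l <= qval R x) p x) ->
  (forall l, (l < L)%N -> c / 2 ^+ l <= \sum_(x | qval R x <= - 2 ^+ l) p x) ->
  \sum_(f | ~~ large_net k ((d - k)%:R * c * L%:R / 8) f) W f <=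
    (B.*2).+1%:R ^+ t * expR (- ((d - k)%:R * c * L%:R / 4 / 2 ^+ L)).
Proof.
move=> hp hn; set a := (d - k)%:R * c * L%:R / 8.
pose u (n : column t B) i : R := qval R (n i) / B%:R.
pose Q (n : column t B) (f : {ffun 'I_d -> column t B}) :=
  [exists i, `|u n i| == 1] &&
  (\sum_(j < d | (k <= j)%N) `|\sum_i u n i * qval R (f j i)| < a).
rewrite (eq_bigl (fun f => [exists n, Q n f])); last first.
  move=> f; rewrite /large_net negb_forall; apply: eq_existsb => n.
  by rewrite negb_imply -ltNge.
apply: (le_trans (union_bound Q W_ge0)).
set e := expR _.
have -> : (B.*2).+1%:R ^+ t * e = \sum_(n : column t B) e.
  by rewrite sumr_const card_ffun !card_ord -natrX mulr_natl.
apply: ler_sum => n _; rewrite /Q.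
have [/existsP[i0 /eqP ui0]|_] /= := boolP [exists i, `|u n i| == 1]; last first.
  by rewrite big_pred0// expR_ge0.
pose X (g : column t B) := `|\sum_i u n i * qval R (g i)|.
have := @lower_tail R 'I_d _ (fun g : column t B => \prod_i p (g i))
  X L c [pred j : 'I_d | (k <= j)%N].
rewrite card_ord_ge; apply => //.
- by move=> g; exact: prodr_ge0.
- by move=> g; exact: normr_ge0.
- by move=> l lL; apply: (anticoncentration (i0 := i0)) => //; [exact: hp|exact: hn].
Qed.

Lemma good_ge (r : 'I_d) (L M : nat) (c1 c2 a : R) : 0 < a -> (0 < B)%N ->
  (forall l, (l < L)%N -> c1 / 2 ^+ l <= \sum_(x | 2 ^+ l <= qval R x) p x) ->
  (forall l, (l < L)%N -> c1 / 2 ^+ l <= \sum_(x | qval R x <= - 2 ^+ l) p x) ->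
  (forall n, (0 < n)%N -> \sum_(x | n%:R <= `|qval R x|) p x <= c2 / n%:R) ->
  1 - ((d * t)%:R * (c2 / B%:R) +
       (t%:R * c2 / 2 ^+ M + t%:R * (1 + c2 * M%:R) / a) +
       (B.*2).+1%:R ^+ t * expR (- ((d - k)%:R * c1 * L%:R / 4 / 2 ^+ L))) <=
  \sum_(f | [&& in_range R f, small_column r a f &
               large_net k ((d - k)%:R * c1 * L%:R / 8) f]) W f.
Proof.
move=> a0 B0 h1 h2 h3.
pose G (f : {ffun 'I_d -> column t B}) :=
  [&& in_range R f, small_column r a f &
  large_net k ((d - k)%:R * c1 * L%:R / 8) f].
rewrite -[leRHS]/(\sum_(f | G f) W f).
have -> : \sum_(f | G f) W f = 1 - \sum_(f | ~~ G f) W f.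
  have W1 : \sum_f W f = 1.
    exact: (@sum_ffun_prod1 _ _ _ (fun g : column t B => \prod_i p (g i))).
  by rewrite -[X in _ = X - _]W1 [X in _ = X - _](bigID G) /= addrK.
rewrite lerD2l lerN2.
rewrite (eq_bigl (fun f => (~~ in_range R f || ~~ small_column r a f) ||
    ~~ large_net k ((d - k)%:R * c1 * L%:R / 8) f)); last first.
  by move=> f; rewrite /G !negb_and orbA.
apply: (le_trans (sum_orb_le _ _ W_ge0)); apply: lerD; last exact: small_net_le.
apply: (le_trans (sum_orb_le _ _ W_ge0)); apply: lerD.
  by apply: out_of_range_le; exact: h3.
apply: large_column_le => // l _.
by have := h3 (2 ^ l)%N; rewrite expn_gt0 natrX; exact.
Qed.

End Good.

(** * From the good event to all row vectors *)

Lemma qval_quant_clamp (R : realType) B (y : R) : - B%:R <= y <= B%:R ->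
  qval R (quant B y) <= y < qval R (quant B y) + 1.
Proof.
move=> /andP[y1 y2].
have yB : 0 <= y + B%:R by lra.
have BE : (B.*2)%:R = B%:R + B%:R :> R by rewrite -addnn natrD.
have tB : (Num.truncn (y + B%:R) <= B.*2)%N.
  rewrite -ltnS truncn_lt_nat//; apply: (@le_lt_trans _ _ (B.*2)%:R).
    by rewrite BE lerD2r.
  by rewrite ltr_nat.
rewrite /qval inordK ?ltnS ?geq_minl// (minn_idPr tB).
have := truncn_itv yB; rewrite -natr1 => /andP[h1 h2].
by apply/andP; split; lra.
Qed.

(** Ensures that rounding a vector of sup norm 1 keeps a coordinate of modulus exactly 1, as the net
    condition demands. *)
Lemma qval_quant_ends (R : realType) B (y : R) : `|y| = B%:R ->
  `|qval R (quant B y)| = B%:R.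
Proof.
move=> yB; have [->|->] : y = B%:R \/ y = - B%:R.
  by move: yB; case: ler0P => _ <-; rewrite ?opprK; [right|left].
- rewrite /qval inordK ?ltnS ?geq_minl// -natrD addnn natrK minnn -addnn natrD.
  by rewrite addrK normr_nat.
- rewrite /qval inordK ?ltnS ?geq_minl// addNr truncn0 minn0 sub0r.
  by rewrite normrN normr_nat.
Qed.

(** The claim is homogeneous in [u], so normalize to sup norm 1 and round to the net. Rounding adds
    at most [t] to the bound on column [r] and removes at most 2t from each tail column. *)
Lemma good_sketch (R : realType) (t d B k : nat) (gamma : R) (S : 'M[R]_(t, d))
    (r : 'I_d) (a b delta : R) :
  0 < gamma -> (0 < B)%N -> 0 <= delta ->
  let f := [ffun j => [ffun i => quant B (S i j / gamma)]] in
  in_range R f -> small_column r a f -> large_net k b f ->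
  delta * (a + t%:R) <= b - (d - k)%:R * (2 * t%:R) ->
  forall u : 'rV[R]_t,
    delta * `|(u *m S) 0 r| <= \sum_(j < d | (k <= j)%N) `|(u *m S) 0 j|.
Proof.
move=> g0 B0 d0 f inr sc ln dab u.
have BR : 0 < B%:R :> R by rewrite ltr0n.
pose s i j := S i j / gamma; pose v i j := qval R (f j i).
have sv i j : `|s i j - v i j| <= 1 /\ `|v i j| <= B%:R.
  have /forallP/(_ (j, i)) /= := inr; rewrite /v /f !ffunE -/(s i j) => h.
  have /andP[h1 h2] := qval_quant_itv h; split; last exact: ltW.
  by rewrite ler_norml; apply/andP; split; lra.
have [u0|] := eqVneq u 0.
  by rewrite u0 mul0mx mxE normr0 mulr0 sumr_ge0.
move=> /rV0Pn[i1 ui1].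
pose i0 := [arg max_(i > i1) `|u 0 i|]%O.
have um i : `|u 0 i| <= `|u 0 i0|.
  by rewrite /i0; case: Order.TotalTheory.arg_maxP => // i2 _; exact.
set m := `|u 0 i0| in um.
have m0 : 0 < m by apply: lt_le_trans (um i1); rewrite normr_gt0.
pose y i := u 0 i / m.
have y1 i : `|y i| <= 1.
  by rewrite /y normrM normfV (gtr0_norm m0) ler_pdivrMr// mul1r.
pose n : column t B := [ffun i => quant B (y i * B%:R)].
pose z i := qval R (n i) / B%:R.
have yz i : `|y i - z i| <= B%:R^-1.
  have : - B%:R <= y i * B%:R <= B%:R.
    have := y1 i; rewrite ler_norml => /andP[? ?].
    by apply/andP; split; nra.
  move=> /qval_quant_clamp/andP[h1 h2].
  have -> : y i - z i = (y i * B%:R - qval R (n i)) / B%:R.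
    by rewrite /z [RHS]mulrBl mulfK// gt_eqF.
  rewrite normrM [X in _ * X]ger0_norm ?invr_ge0 ?(ltW BR)//.
  rewrite -[leRHS]mul1r ler_pM2r ?invr_gt0// /n ffunE ger0_norm; lra.
have zi0 : [exists i, `|qval R (n i) / B%:R| == 1].
  apply/existsP; exists i0; rewrite normrM [X in _ * X]ger0_norm ?invr_ge0 ?(ltW BR)//.
  rewrite /n ffunE qval_quant_ends; first by rewrite divff// gt_eqF.
  by rewrite normrM normr_nat /y normrM normfV -/m (gtr0_norm m0) divff ?gt_eqF// mul1r.
have uS j : (u *m S) 0 j = m * gamma * \sum_i y i * s i j.
  rewrite mxE mulr_sumr; apply: eq_bigr => i _; rewrite /y /s.
  by field; rewrite !gt_eqF.
have nb : b <= \sum_(j < d | (k <= j)%N) `|\sum_i z i * v i j|.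
  by have /forallP/(_ n)/implyP/(_ zi0) := ln.
have colr : `|\sum_i y i * s i r| <= a + t%:R.
  apply: (le_trans (ler_norm_sum _ _ _)).
  apply: (@le_trans _ _ (\sum_i (`|v i r| + 1))).
    apply: ler_sum => i _; rewrite normrM.
    apply: (@le_trans _ _ `|s i r|); first by rewrite ler_piMl.
    rewrite -[s i r](subrK (v i r)) addrC.
    apply: (le_trans (ler_normD _ _)).
    by rewrite lerD2l; case: (sv i r).
  by rewrite big_split /= sumr_const card_ord lerD2r.
have colj j : `|\sum_i z i * v i j| - 2 * t%:R <= `|\sum_i y i * s i j|.
  rewrite lerBlDr -lerBlDl; apply: (le_trans (lerB_dist _ _)).
  rewrite -sumrB; apply: (le_trans (ler_norm_sum _ _ _)).
  have -> : 2 * t%:R = \sum_(i < t) (2 : R) by rewrite sumr_const card_ord mulr_natr.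
  apply: ler_sum => i _.
  (* Two rounding errors: [y] to [z] costs 1/B against |v| <= B, and [s] to [v] costs 1 against |y|
     <= 1. *)
  have -> : z i * v i j - y i * s i j =
      - ((y i - z i) * v i j + y i * (s i j - v i j)) by ring.
  rewrite normrN; apply: (le_trans (ler_normD _ _)).
  rewrite (normrM (y i - z i)) (normrM (y i)).
  have [h1 h2] := sv i j.
  apply: (@le_trans _ _ (B%:R^-1 * B%:R + 1 * 1)).
    by apply: lerD; exact: ler_pM.
  by rewrite mulVf ?gt_eqF// mulr1.
under eq_bigr do rewrite uS normrM.
rewrite uS normrM mulrCA -mulr_sumr; apply: ler_wpM2l => //.
apply: (@le_trans _ _ (delta * (a + t%:R))); first exact: ler_wpM2l.
apply: (le_trans dab).
apply: (@le_trans _ _ (\sum_(j < d | (k <= j)%N) (`|\sum_i z i * v i j| - 2 * t%:R))).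
  rewrite sumrB lerB// sumr_const card_ord_ge.
  by rewrite [leRHS]mulr_natl.
by apply: ler_sum.
Qed.

(** * Choice of the parameters *)

Lemma ln2_ge (R : realType) : 2^-1 <= ln 2 :> R.
Proof.
have := @le_ln1Dx R (- 2^-1) ltac:(lra).
rewrite (_ : 1 + - 2^-1 = 2^-1); last by lra.
by rewrite lnV ?posrE//; lra.
Qed.

Lemma expR_ge_exp2 (R : realType) (n : nat) : 2 ^+ n <= expR n%:R :> R.
Proof.
rewrite -[n%:R]mulr1 expRM_natl; apply: lerXn2r; rewrite ?nnegrE ?expR_ge0//.
by have := @expR_ge1Dx R 1; lra.
Qed.

(** 11 is the least L for which this holds; the constants are those that [net_budget] consumes. *)
Lemma linear_le_exp2 (L : nat) : (11 <= L)%N -> (4 * L + 1600 <= 2 ^ L)%N.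
Proof.
elim: L => // L IH; rewrite leq_eqVlt => /predU1P[<-//|L11].
by rewrite expnS; have := IH L11; lia.
Qed.

Lemma trunc_log_gt0_arg (b d : nat) : (0 < trunc_log b d)%N -> (0 < d)%N.
Proof. by case: d => //; rewrite trunc_log0. Qed.

Lemma ln_le_trunc_log (R : realType) (d : nat) : (11 <= trunc_log 4 d)%N ->
  ln d%:R <= 6 * (trunc_log 4 d)%:R :> R.
Proof.
set L := trunc_log 4 d => L11.
have dL : (d < 4 ^ L.+1)%N by apply: trunc_log_ltn.
have d0 : (0 < d)%N by apply: (@trunc_log_gt0_arg 4); apply: leq_trans L11.
apply: (@le_trans _ _ (ln (4 ^+ L.+1))).
  rewrite ler_ln ?posrE ?ltr0n ?exprn_gt0//.
  by rewrite -natrX ler_nat ltnW.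
rewrite lnXn// -[ln 4 *+ _]mulr_natr.
have ln4 : ln 4 <= 3 :> R.
  have := @le_ln1Dx R 3 ltac:(lra).
  by rewrite (_ : 1 + 3 = 4)//; lra.
have LR : 11 <= L%:R :> R by rewrite ler_nat.
rewrite -[L.+1%:R]natr1.
have : ln 4 * (L%:R + 1) <= 3 * (L%:R + 1) :> R by apply: ler_wpM2r => //; lra.
by move=> h; lra.
Qed.

(** The net has at most d^(4t) <= exp(24 L t) points. Since 4^L <= d and k is small, (d - k) / 2^L
    is at least 2^L / 2, so the negative exponent is of order L 2^L and wins. *)
Lemma net_budget (R : realType) (d t k L : nat) : L = trunc_log 4 d ->
  (11 <= L)%N -> (k <= t)%N -> (1000 * t <= L)%N ->
  ((d ^ 3).*2).+1%:R ^+ t *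
    expR (- ((d - k)%:R * 20^-1 * L%:R / 4 / 2 ^+ L)) <= 1000^-1 :> R.
Proof.
move=> LE L11 kt tL.
have dL : (d < 4 ^ L.+1)%N by rewrite LE; apply: trunc_log_ltn.
have d0 : (0 < d)%N.
  by apply: (@trunc_log_gt0_arg 4); rewrite -LE; apply: leq_trans L11.
have Ld : (4 ^ L <= d)%N by rewrite LE; apply: trunc_logP.
have d3 : (3 <= d)%N.
  apply: leq_trans Ld; apply: (@leq_trans L); first exact: leq_trans L11.
  by apply: ltnW; apply: ltn_expl.
have LR : 11 <= L%:R :> R by rewrite ler_nat.
have B4 : ((d ^ 3).*2.+1 <= (4 ^ L.+1) ^ 4)%N.
  apply: (@leq_trans (d ^ 4)); last by rewrite leq_exp2r// ltnW.
  rewrite -muln2 (expnS d 3).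
  have : (0 < d ^ 3)%N by rewrite expn_gt0 d0.
  move: (d ^ 3)%N => D D0; nia.
have e3 : 4 <= expR 3 :> R by have := @expR_ge1Dx R 3; lra.
have tR : 1000 * t%:R <= L%:R :> R by rewrite -natrM ler_nat.
have bnd : ((d ^ 3).*2).+1%:R ^+ t <= expR (24 * L%:R * t%:R) :> R.
  apply: (@le_trans _ _ (expR (12 * L.+1%:R) ^+ t)).
    apply: lerXn2r; rewrite ?nnegrE ?expR_ge0//.
    apply: (@le_trans _ _ ((4 ^+ L.+1) ^+ 4)).
      by rewrite -!natrX ler_nat.
    rewrite (_ : 12 * L.+1%:R = 4%:R * (L.+1%:R * 3)); last by rewrite -natrM; ring.
    rewrite !expRM_natl; do 2 (apply: lerXn2r; rewrite ?nnegrE ?exprn_ge0 ?expR_ge0//).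
  rewrite -expRM_natl ler_expR -[L.+1%:R]natr1; have : 0 <= t%:R :> R by [].
  nra.
have p0 : 0 < 2 ^+ L :> R by rewrite exprn_gt0.
have LL := linear_le_exp2 L11.
have {}LL : 4 * L%:R + 1600 <= 2 ^+ L :> R.
  by rewrite -natrX -natrM -natrD ler_nat.
have dk : 2 ^+ L / 2 <= (d - k)%:R / 2 ^+ L :> R.
  rewrite ler_pdivlMr//.
  have h : (2 ^ L * 2 ^ L <= d)%N by rewrite -expnMn.
  have {}h : 2 ^+ L * 2 ^+ L <= d%:R :> R by rewrite -natrX -natrM ler_nat.
  have tR0 : 0 <= t%:R :> R by [].
  have kR : k%:R <= t%:R :> R by rewrite ler_nat.
  have kd : (k <= d)%N.
    apply: (leq_trans kt); apply: (@leq_trans L).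
      by apply: leq_trans tL; rewrite leq_pmull.
    by apply: leq_trans Ld; apply: ltnW; apply: ltn_expl.
  rewrite natrB//; nra.
apply: (@le_trans _ _ (expR (- 10%:R))); last first.
  have h : 1000 <= 2 ^+ 10 :> R by lra.
  have {}h := le_trans h (expR_ge_exp2 R 10).
  rewrite expRN; have := expR_gt0 (10%:R : R); move: (expR _) h => e h e0.
  by rewrite -[leLHS]mul1r ler_pdivrMr//; lra.
apply: (@le_trans _ _ (expR (24 * L%:R * t%:R) *
    expR (- ((d - k)%:R * 20^-1 * L%:R / 4 / 2 ^+ L)))).
  by apply: ler_wpM2r => //; exact: expR_ge0.
rewrite -expRD ler_expR.
set D := (d - k)%:R / 2 ^+ L in dk.
rewrite (_ : (d - k)%:R * 20^-1 * L%:R / 4 / 2 ^+ L = D * (L%:R / 80)); last first.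
  by rewrite /D; field; rewrite gt_eqF.
(* The left side is L^2 / 40 + 10 L: its quadratic part absorbs 24 L^2 / 1000, and its linear part
   leaves at least 10. *)
have h1 : (2 * L%:R + 800) * (L%:R / 80) <= D * (L%:R / 80).
  by apply: ler_wpM2r; lra.
have h2 : 24 * L%:R * t%:R <= 24 * L%:R * (L%:R / 1000) :> R.
  by apply: ler_wpM2l; lra.
nra.
Qed.

(** [M] makes 2^M at least 1024 t, so a huge entry in the column is unlikely, yet keeps M = O(log
    t), whence the t log t size of the column. *)
Lemma column_budget (R : realType) (t : nat) : (0 < t)%N ->
  let M := (trunc_log 2 t + 11)%N in
  t%:R * 2 / 2 ^+ M <= 500^-1 :> R /\
  500 * t%:R * (1 + 2 * M%:R) + t%:R <= 26 * 1000 * (t%:R * ln (maxn 2 t)%:R) :> R.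
Proof.
move=> t0 M; have tR : 0 < t%:R :> R by rewrite ltr0n.
split.
  have h : (t < 2 ^ (trunc_log 2 t).+1)%N by apply: trunc_log_ltn.
  have hM : (1024 * t <= 2 ^ M)%N.
    rewrite /M addnS -addSn expnD mulnC; apply: leq_mul => //; exact: ltnW.
  have {}hM : 1024 * t%:R <= 2 ^+ M :> R by rewrite -natrX -natrM ler_nat.
  rewrite ler_pdivrMr ?exprn_gt0//; lra.
set l : R := ln _.
have ln2 := ln2_ge R.
have l2 : ln 2 <= l by rewrite ler_ln ?posrE ?ltr0n ?leq_max// ler_nat leq_max.
have lt : (trunc_log 2 t)%:R * ln 2 <= l.
  rewrite mulr_natl -lnXn// ler_ln ?posrE ?exprn_gt0// ?ltr0n ?leq_max//.
  by rewrite -natrX ler_nat leq_max trunc_logP// orbT.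
(* As ln 2 >= 1/2, the logarithm contributes at most 2 l and the constant 11 at most 22 l. *)
have Ml : M%:R <= 24 * l.
  rewrite /M natrD; have : 0 <= (trunc_log 2 t)%:R :> R by [].
  nra.
have -> : 500 * t%:R * (1 + 2 * M%:R) + t%:R = t%:R * (501 + 1000 * M%:R) :> R.
  by ring.
rewrite mulrCA; apply: ler_wpM2l; lra.
Qed.

Lemma trunc_log_ge11 (d : nat) : (11 <= trunc_log 4 d)%N -> (2000 <= d)%N.
Proof.
move=> L11; have d0 : (0 < d)%N.
  by apply: (@trunc_log_gt0_arg 4); apply: leq_trans L11.
apply: leq_trans (trunc_logP (isT : 1 < 4)%N d0).
rewrite (expnMn 2 2); have := linear_le_exp2 L11.
move: (2 ^ _)%N => z; move: (trunc_log 4 d) => L; clear => h.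
have z2 : (1600 <= z)%N by apply: leq_trans h; exact: leq_addl.
apply: (@leq_trans (z * 2)%N); first by lia.
by rewrite leq_mul2l (leq_trans _ z2) ?orbT.
Qed.

(** The reason for clamping at d^3: d t <= d^2 entries, each out of range with probability at most 2
    / d^3. *)
Lemma range_budget (R : realType) (d t : nat) : (2000 <= d)%N -> (t <= d)%N ->
  (d * t)%:R * (2 / (d ^ 3)%:R) <= 1000^-1 :> R.
Proof.
move=> d2 td; have d0 : (0 < d ^ 3)%N by rewrite expn_gt0 (leq_trans _ d2).
have : (d * t * 2000 <= d ^ 3)%N.
  by rewrite !expnS expn0 muln1 -mulnA leq_mul2l leq_mul ?orbT.
rewrite -(@ler_nat R) natrM => h.
by rewrite mulrA ler_pdivrMr ?ltr0n//; lra.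
Qed.

(** Fixes the final constant: 320 * 26000 * 2 = 16640000, whose reciprocal is just above 6 / 10^8;
    the 6 comes from [ln_le_trunc_log]. *)
Lemma gap_rate (R : realType) (D L q : R) : 0 <= D -> 0 <= L -> 0 <= q ->
  10 ^- 8 * (6 * L * q * D) <= D * L * q / 320 / 26 / 1000 / 2.
Proof.
move=> D0 L0 q0; have -> : 6 * L * q * D = 6 * (D * L * q) by ring.
have : 0 <= D * L * q by rewrite !mulr_ge0.
by move: (D * L * q) => Z Z0; lra.
Qed.

Lemma gap_ge0 (R : realType) (D L q : R) : 0 <= D -> 0 <= L -> 0 <= q ->
  0 <= D * L * q / 320 / 26 / 1000.
Proof.
move=> D0 L0 q0; have : 0 <= D * L * q by rewrite !mulr_ge0.
by move: (D * L * q) => Z Z0; lra.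
Qed.

Lemma gap_le (R : realType) (D L q d : R) :
  0 <= D <= d -> 0 <= L <= d -> 0 <= q <= 2 ->
  D * L * q / 320 / 26 / 1000 <= 2 * d ^+ 2.
Proof.
move=> /andP[D0 Dd] /andP[L0 Ld] /andP[q0 q2].
have : D * L * q <= d * d * 2.
  by apply: ler_pM => //; [exact: mulr_ge0|exact: ler_pM].
have : 0 <= d * d by apply: mulr_ge0; exact: le_trans Dd.
rewrite expr2; move: (D * L * q) (d * d) => Z Z' Z0 h; lra.
Qed.

(** The left side is D L / 320, half of the net bound D L / 160; the other half covers the rounding
    loss, since 2t <= L / 500. *)
Lemma gap_cross (R : realType) (D L q t tl : R) : q * tl = 1 -> 0 <= D ->
  0 <= L -> 1000 * t <= L ->
  D * L * q / 320 / 26 / 1000 * (26 * 1000 * tl) <=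
    D * 20^-1 * L / 8 - D * (2 * t).
Proof.
move=> qt D0 L0 tL.
have -> : D * L * q / 320 / 26 / 1000 * (26 * 1000 * tl) =
    D * L * (q * tl) / 320 by field.
rewrite qt mulr1.
have : D * (2 * t) <= D * (L / 320) by apply: ler_wpM2l => //; lra.
have -> : D * (L / 320) = D * L / 320 by ring.
have -> : D * 20^-1 * L / 8 = D * L / 160 by field.
by move: (D * L) (D * (2 * t)) => Z Z'; lra.
Qed.

(* [delta] above; 320 comes from the lower bound [(d - k) L / 160 - 2 t (d - k)]
   on the tail columns, 26000 from the bound on the sum of column [k - 1]. *)
Definition sketch_gap (R : realType) (t d k : nat) : R :=
  (d - k)%:R * (trunc_log 4 d)%:R * (t%:R * ln (maxn 2 t)%:R)^-1 / 320 / 26 / 1000.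

Lemma ln_max2_ge (R : realType) (t : nat) : 2^-1 <= ln (maxn 2 t)%:R :> R.
Proof.
apply: (le_trans (ln2_ge R)); rewrite ler_ln ?posrE ?ltr0n ?leq_max//.
by rewrite ler_nat leq_max.
Qed.

Lemma sketch_gapP (R : realType) (t d k : nat) : (0 < t)%N -> (k <= d)%N ->
  (11 <= trunc_log 4 d)%N ->
  10 ^- 8 * rate R d t * min_rank_err k (hard_matrix R d k) <=
    sketch_gap R t d k / 2 /\ 0 <= sketch_gap R t d k <= 2 * d%:R ^+ 2.
Proof.
move=> t0 kd L11.
have d0 : (0 < d)%N by apply: (@trunc_log_gt0_arg 4); apply: leq_trans L11.
have Ld : (trunc_log 4 d < d)%N.
  by apply: leq_trans (trunc_logP (isT : 1 < 4)%N d0); apply: ltn_expl.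
have tR : 1 <= t%:R :> R by rewrite ler1n.
have lnd := ln_le_trunc_log R L11.
have lnd0 : 0 <= ln d%:R :> R by rewrite ln_ge0// ler1n.
have l2 := ln_max2_ge R t.
rewrite /sketch_gap /rate; set L := trunc_log 4 d in L11 Ld lnd *.
set l : R := ln (maxn 2 t)%:R in l2 *; set q := (t%:R * l)^-1.
have l0 : 0 < l by apply: lt_le_trans l2.
have tl0 : 0 < t%:R * l by apply: mulr_gt0 => //; rewrite ltr0n.
have q0 : 0 <= q by rewrite invr_ge0 ltW.
have q2 : q <= 2.
  rewrite -[leRHS]invrK lef_pV2 ?posrE//; apply: (le_trans l2).
  by rewrite ler_peMl// ltW.
have D0 : 0 <= (d - k)%:R :> R by exact: ler0n.
split; last first.
  apply/andP; split; first exact: gap_ge0.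
  by apply: gap_le; apply/andP; split; rewrite ?ler_nat ?leq_subr// ltnW.
apply: le_trans (gap_rate D0 (ler0n R L) q0).
rewrite -mulrA; apply: ler_wpM2l; first by rewrite invr_ge0 exprn_ge0.
apply: (@le_trans _ _ (ln d%:R * q * (d - k)%:R)).
  apply: ler_wpM2l; first exact: mulr_ge0.
  exact: hard_matrix_rank_err_le.
by do 2 (apply: ler_wpM2r => //).
Qed.

(** * Probability bound in a fixed dimension, then the asymptotic statement *)

Lemma hard_matrix_sketch_prob (R : realType) (t d k : nat) (gamma : R)
    (disp : measure_display) (T : measurableType disp) (P : probability T R)
    (S : 'I_t -> 'I_d -> {RV P >-> R}) :
  0 < gamma -> iid_cauchy gamma S -> (0 < k <= t)%N -> (11 <= trunc_log 4 d)%N ->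
  (1000 * t <= trunc_log 4 d)%N ->
  ((99 / 100)%:E <=
   P [set w | (10 ^- 8 * rate R d t * min_rank_err k (hard_matrix R d k)
              <= min_sketch_err (sample_matrix S w) (hard_matrix R d k))%R])%E.
Proof.
move=> g0 iid /andP[k0 kt]; set L := trunc_log 4 d => L11 tL.
have t0 : (0 < t)%N by exact: leq_trans kt.
have d0 : (0 < d)%N by apply: (@trunc_log_gt0_arg 4); apply: leq_trans L11.
have Ld4 : (4 ^ L <= d)%N by apply: trunc_logP.
have Ld : (L < d)%N by apply: leq_trans Ld4; apply: ltn_expl.
have td : (t <= d)%N.
  by apply: ltnW; apply: leq_ltn_trans Ld; apply: leq_trans tL; rewrite leq_pmull.
have kd : (k < d)%N.
  apply: leq_ltn_trans Ld; apply: (leq_trans kt); apply: leq_trans tL; exact: leq_pmull.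
have rd : (k.-1 < d)%N by exact: leq_ltn_trans (leq_pred _) kd.
pose r := Ordinal rd; pose B := (d ^ 3)%N.
have B0 : (0 < B)%N by rewrite expn_gt0 d0.
have dB : (d <= B)%N by rewrite /B expnS leq_pmulr// expn_gt0 d0.
pose M := (trunc_log 2 t + 11)%N.
(* The factor 500 makes the Markov term of the column bound exactly 1/500. *)
pose a : R := 500 * t%:R * (1 + 2 * M%:R).
have [col1 col2] := column_budget R t0; rewrite -/M in col1 col2.
have tR : 1 <= t%:R :> R by rewrite ler1n.
have M0 : 0 <= M%:R :> R by exact: ler0n.
have a0 : 0 < a by rewrite /a; apply: mulr_gt0; lra.
have tLR : 1000 * t%:R <= L%:R :> R by rewrite -natrM ler_nat.
have [gap1 gap2] := sketch_gapP R t0 (ltnW kd) L11.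
have [ind law] := iid; pose lawX := law (Ordinal t0) r.
apply: le_trans (iid_quant_ge (B := B) (Q := fun f => [&& in_range R f,
  small_column r a f & large_net k ((d - k)%:R * 20^-1 * L%:R / 8) f]) g0 iid _ _).
- rewrite lee_fin; apply: le_trans (@good_ge R t d B k (cell_prob gamma) _ _ r L M
    20^-1 2 a a0 B0 _ _ _).
  + rewrite -/B.
    have := @net_budget R d t k L erefl L11 kt tL; rewrite -/B => net.
    have range := range_budget R (trunc_log_ge11 L11) td; rewrite -/B in range.
    have col3 : t%:R * (1 + 2 * M%:R) / a = 500^-1.
      have e : 1 + 2 * M%:R != 0 :> R.
        by apply/lt0r_neq0; apply: ltr_wpDr => //; apply: mulr_ge0.
      have e' : t%:R != 0 :> R by rewrite pnatr_eq0 -lt0n.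
      by rewrite /a; field; apply/andP; split.
    (* Failure budget: 1/1000 for range, 1/500 + 1/500 for the column, 1/1000 for the net, in all
       6/1000 < 1/100. *)
    rewrite col3; lra.
  + exact: (cell_prob_ge0 lawX).
  + exact: (cell_prob_sum1 lawX).
  (* The levels stay within the clamp: 2^m <= 2^L <= 4^L <= d <= B. *)
  + move=> m mL; have := @cell_prob_upper _ _ _ _ _ _ g0 lawX B (2 ^ m)%N.
    rewrite natrX invfM => h; apply: h; rewrite expn_gt0/=.
    apply: leq_trans dB; apply: leq_trans Ld4; rewrite (@leq_trans (2 ^ L))//.
      by rewrite leq_exp2l// ltnW.
    by rewrite leq_exp2r// (leq_trans _ L11).
  + move=> m mL; have := @cell_prob_lower _ _ _ _ _ _ g0 lawX B (2 ^ m)%N.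
    rewrite natrX invfM => h; apply: h; rewrite expn_gt0/=.
    apply: leq_trans dB; apply: leq_trans Ld4; rewrite (@leq_trans (2 ^ L))//.
      by rewrite leq_exp2l// ltnW.
    by rewrite leq_exp2r// (leq_trans _ L11).
  + by move=> n n0; exact: (cell_prob_tail g0 lawX).
- exact: measurable_sketch_event.
move=> w /and3P[h1 h2 h3]; apply/le_min_sketch_err => U.
apply: (le_trans gap1).
apply: (@hard_matrix_sketch _ _ _ _ _ _ r) => //.
- by rewrite /= prednK.
- pose f := [ffun j => [ffun i => quant B (sample_matrix S w i j / gamma)]].
  have fE : f = [ffun j => [ffun i => quant B (S i j w / gamma)]].
    by apply/ffunP => j; apply/ffunP => i; rewrite !ffunE mxE.
  rewrite -fE in h1 h2 h3.
  have gap0 : 0 <= sketch_gap R t d k by case/andP: gap2.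
  apply: (good_sketch g0 B0 gap0 h1 h2 h3).
  apply: (le_trans (ler_wpM2l gap0 col2)).
  have tl0 : 0 < t%:R * ln (maxn 2 t)%:R :> R.
    by apply: mulr_gt0; [rewrite ltr0n|apply: lt_le_trans (ln_max2_ge R t)].
  by apply: (gap_cross (mulVf (lt0r_neq0 tl0))).
Qed.

Lemma trunc_log_near (n : nat) : \forall d \near \oo, (n <= trunc_log 4 d)%N.
Proof. by exists (4 ^ n)%N => // d /= nd; exact: trunc_log_max. Qed.

Theorem theoremG2 (R : realType) :
  exists c : R, 0 < c /\
  forall k : nat -> nat, (forall d, (1 <= k d)%N) ->
  exists A : forall d : nat, 'M[R]_d,
    (forall d, (k d < d)%N -> 0 < min_rank_err (k d) (A d)) /\
    forall t : nat -> nat,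
      (forall d, (1 <= t d)%N) ->
      (fun d : nat => (t d)%:R : R^o) =o_\oo (fun d : nat => ln (d%:R : R) : R^o) ->
      \forall d \near \oo,
      forall (gamma : R), 0 < gamma ->
      forall (disp : measure_display) (T : measurableType disp)
        (P : probability T R) (S : 'I_(t d) -> 'I_d -> {RV P >-> R}),
        iid_cauchy gamma S ->
        ((99 / 100)%:E <=
         P [set w | c * rate R d (t d) * min_rank_err (k d) (A d)
                    <= min_sketch_err (sample_matrix S w) (A d)]%R)%E.
Proof.
exists (10 ^- 8); split; first by rewrite invr_gt0 exprn_gt0.
move=> k k1; exists (fun d => hard_matrix R d (k d)); split.
  by move=> d; exact: hard_matrix_rank_err_gt0.
move=> t t1 /eqoP to.
(* With ln d <= 6 L, this choice turns t = o(log d) into 1000 t <= L. The threshold on [d] is fixed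
   before [gamma] and [S]. *)
have e0 : (0 : R) < (6 * 1000)^-1 by lra.
have {}to := to _ e0.
near=> d.
have L11 : (11 <= trunc_log 4 d)%N.
  by near: d; exact: trunc_log_near.
have td : `|(t d)%:R : R^o| <= (6 * 1000)^-1 * `|ln d%:R : R^o| by near: d.
move=> gamma g0 disp T P S iid.
have d0 : (0 < d)%N by apply: (@trunc_log_gt0_arg 4); apply: leq_trans L11.
have lnd0 : 0 <= ln d%:R :> R by rewrite ln_ge0// ler1n.
have lnd := ln_le_trunc_log R L11.
have tL : (1000 * t d <= trunc_log 4 d)%N.
  rewrite -(@ler_nat R) natrM; move: td; rewrite normr_nat ger0_norm//.
  by lra.
have whole : (forall w, 10 ^- 8 * rate R d (t d) *
      min_rank_err (k d) (hard_matrix R d (k d)) <=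
      min_sketch_err (sample_matrix S w) (hard_matrix R d (k d))) ->
    ((99 / 100)%:E <= P [set w | (10 ^- 8 * rate R d (t d) *
      min_rank_err (k d) (hard_matrix R d (k d)) <=
      min_sketch_err (sample_matrix S w) (hard_matrix R d (k d)))%R])%E.
  move=> h; rewrite (_ : [set _ | _] = setT); last first.
    by apply/seteqP; split => // w _; exact: h.
  by rewrite probability_setT lee_fin; lra.
have l2 := ln_max2_ge R (t d).
have tR : 1 <= (t d)%:R :> R by rewrite ler1n.
have rate0 : 0 <= rate R d (t d).
  by rewrite /rate divr_ge0// mulr_ge0//; lra.
have c0 : 0 <= 10 ^- 8 :> R by rewrite invr_ge0 exprn_ge0.
(* For d <= k the matrix is its own rank-k approximation and the right side is at most 0. *)
have [dk|kd] := leqP d (k d).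
  apply: whole => w; apply/le_min_sketch_err => U.
  apply: le_trans (l1norm_ge0 _); apply: mulr_ge0_le0; first exact: mulr_ge0.
  apply: (@le_trans _ _ (l1norm (hard_matrix R d (k d) - hard_matrix R d (k d)))).
    by apply: min_rank_err_le; apply: leq_trans dk; exact: rank_leq_row.
  by rewrite subrr /l1norm big1// => i _; rewrite big1// => j _; rewrite mxE normr0.
have [kt|tk] := leqP (k d) (t d).
  by apply: (hard_matrix_sketch_prob g0 iid) => //; rewrite k1.
(* For t < k the bound is deterministic: the error is at least 2 d^2, which exceeds half the gap for
   every outcome. *)
have [gap1 /andP[gap0 gap2]] := sketch_gapP R (t1 d) (ltnW kd) L11.
apply: whole => w; apply/le_min_sketch_err => U.
apply: (le_trans gap1); apply: le_trans (hard_matrix_low_rank _ _ _); last first.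
  by rewrite tk ltnW.
apply: le_trans gap2; move: gap0; clear; move: (sketch_gap _ _ _ _) => z z0; lra.
Unshelve. all: by end_near.
Qed.
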